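(* Let $\nu\in[0,1)$, $0<R<1$ and write $R=e^{-a}$ with $a>0$. There exist real coefficients $\tilde a_p(R,\nu)$, $p\ge1$, such that for all sufficiently small $t>0$, $$\mathrm{Tr}\,(e^{-t\mathcal M_{\nu,S^1,S^1}(R)})=\frac{\cosh\big(t(\nu-\frac12)\big)}{\sinh\frac t2}+\sum_{p\ge1}\tilde a_p(R,\nu)\,t^p,$$ with $$\tilde a_1(R,\nu)=-\sum_{m\in\mathbb Z}|m-\nu|\big(\coth(a|m-\nu|)-1\big).$$ In particular, as $t\to0^+$, $$\mathrm{Tr}\,(e^{-t\mathcal M_{\nu,S^1,S^1}(R)})=\frac2t+\Big(\frac16-\nu+\nu^2+\tilde a_1(R,\nu)\Big)t+\mathcal O(t^2).$$
   Context: Let $\Omega=\{(r,\theta):R<r<1\}\subset\mathbb R^2$ (polar coordinates) be the annulus with outer radius $1$ and inner radius $R$, with boundary $\partial\Omega=S^1\cup S^R$, where $S^\rho$ is the circle of radius $\rho$ centered at $0$. Let $A_\nu(x,y)=\frac\nu{r^2}(-y,x)$ be the Aharonov–Bohm potential and $H=(D-A_\nu)^2$, $D=-i\nabla$. The partial Dirichlet-to-Neumann operator $\mathcal M_{\nu,S^1,S^1}(R)$ maps $\psi\in H^{1/2}(S^1)$ to $\partial_ru|_{r=1}$, where $u$ is the unique solution of $Hu=0$ in $\Omega$, $u=\psi$ on $S^1$, $u=0$ on $S^R$. When $\nu=0$, the $m=0$ term $|m-\nu|(\coth(a|m-\nu|)-1)$ is understood as its limit $1/a$. *)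

(* Defs.v *)
From mathcomp Require Import all_boot all_order all_algebra.
From mathcomp Require Import all_classical all_reals all_analysis.
From mathcomp Require Export complex.

Set Implicit Arguments.
Unset Strict Implicit.
Unset Printing Implicit Defensive.

Import Order.TTheory GRing.Theory Num.Theory numFieldNormedType.Exports.

Local Open Scope classical_set_scope.
Local Open Scope ring_scope.
Local Open Scope complex_scope.

Definition cosh (R : realType) (x : R) : R := (expR x + expR (- x)) / 2.
Definition sinh (R : realType) (x : R) : R := (expR x - expR (- x)) / 2.
Definition coth (R : realType) (x : R) : R := cosh x / sinh x.

(* Functions on the circle S^1 are given in the angular variable, as functions
   R -> R[i] of which only the values on [0, 2 pi] matter; equality in L^2(S^1)
   is equality almost everywhere on [0, 2 pi]. *)

Definition circle (R : realType) : set R := `[0, 2 * pi]%classic.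

Definition circle_int (R : realType) (f : R -> R[i]) : R[i] :=
  Rintegral lebesgue_measure (@circle R) (fun x => complex.Re (f x)) +i*
  Rintegral lebesgue_measure (@circle R) (fun x => complex.Im (f x)).

Definition sqmod (R : realType) (z : R[i]) : R :=
  complex.Re z ^+ 2 + complex.Im z ^+ 2.

(* Extended-real valued, so that it is meaningful for every measurable f. *)
Definition L2norm2 (R : realType) (f : R -> R[i]) : \bar R :=
  (\int[lebesgue_measure]_(x in @circle R) (sqmod (f x))%:E)%E.

Definition inL2 (R : realType) (f : R -> R[i]) : Prop :=
  [/\ measurable_fun (@circle R) (fun x => complex.Re (f x)),
      measurable_fun (@circle R) (fun x => complex.Im (f x)) &
      (L2norm2 f < +oo)%E].

Definition L2dot (R : realType) (f g : R -> R[i]) : R[i] :=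
  circle_int (fun x => f x * conjc (g x)).

Definition L2cvg (R : realType) (f : nat -> R -> R[i]) (g : R -> R[i]) : Prop :=
  (fun n => L2norm2 (fun x => f n x - g x)) @ \oo --> 0%E.

Definition orthonormal_basis (R : realType) (e : nat -> R -> R[i]) : Prop :=
  [/\ forall k, inL2 (e k),
      forall j k, L2dot (e j) (e k) = (j == k)%:R &
      forall f, inL2 f ->
        L2cvg (fun n x => \sum_(k < n) L2dot f (e k) * e k x) f].

(* Sobolev spaces H^s(S^1) through Fourier coefficients. *)

Definition fourier (R : realType) (f : R -> R[i]) (m : int) : R[i] :=
  ((2 * pi)^-1)%:C *
  circle_int (fun x => f x * (cos (m%:~R * x) -i* sin (m%:~R * x))).

Definition Hnorm2 (R : realType) (s : R) (c : int -> R[i]) : \bar R :=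
  (\esum_(m in [set: int]) ((1 + m%:~R ^+ 2) `^ s * sqmod (c m))%:E)%E.

Definition inHhalf (R : realType) (psi : R -> R[i]) : Prop :=
  inL2 psi /\ (Hnorm2 2^-1 (fourier psi) < +oo)%E.

(* Complex-valued functions on the plane and their derivatives. *)

Definition radius (R : realType) (p : R * R) : R :=
  Num.sqrt (p.1 ^+ 2 + p.2 ^+ 2).

Definition annulus (R : realType) (rho : R) : set (R * R) :=
  [set p | rho < radius p < 1].

Definition dir1 (R : realType) : R * R := (1, 0).
Definition dir2 (R : realType) : R * R := (0, 1).

Definition cderive (R : realType) (v : R * R) (u : R * R -> R[i])
    (p : R * R) : R[i] :=
  'D_v (fun q => complex.Re (u q)) p +i* 'D_v (fun q => complex.Im (u q)) p.

Definition C1_on (R : realType) (D : set (R * R)) (f : R * R -> R) : Prop :=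
  forall p, D p -> forall v, v = dir1 R \/ v = dir2 R ->
    derivable f p v /\ {for p, continuous (fun q => 'D_v f q : R)}.

Definition C2_on (R : realType) (D : set (R * R)) (f : R * R -> R) : Prop :=
  C1_on D f /\
  forall v, v = dir1 R \/ v = dir2 R -> C1_on D (fun q => 'D_v f q : R).

(* The Aharonov-Bohm potential. *)
Definition AB1 (R : realType) (nu : R) (p : R * R) : R :=
  nu / radius p ^+ 2 * - p.2.
Definition AB2 (R : realType) (nu : R) (p : R * R) : R :=
  nu / radius p ^+ 2 * p.1.

(* The operator D_v - A_v, with D_v = - i d_v. *)
Definition momentum (R : realType) (v : R * R) (A : R * R -> R)
    (u : R * R -> R[i]) (p : R * R) : R[i] :=
  (0 -i* 1) * cderive v u p - (A p)%:C * u p.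

Definition AB_hamiltonian (R : realType) (nu : R) (u : R * R -> R[i]) :
    R * R -> R[i] :=
  fun p => momentum (dir1 R) (AB1 nu) (momentum (dir1 R) (AB1 nu) u) p +
           momentum (dir2 R) (AB2 nu) (momentum (dir2 R) (AB2 nu) u) p.

Definition polar (R : realType) (r x : R) : R * R := (r * cos x, r * sin x).

Definition on_circle (R : realType) (u : R * R -> R[i]) (r : R) : R -> R[i] :=
  fun x => u (polar r x).

Definition radial_derive (R : realType) (u : R * R -> R[i]) (r : R) :
    R -> R[i] :=
  fun x => cderive (cos x, sin x) u (polar r x).

(* u solves H u = 0 in the annulus, u = psi on S^1, u = 0 on S^rho.  By interior
   elliptic regularity the H^1 solutions are smooth inside; the boundary values
   are the limits in H^(1/2) of the restrictions to concentric circles. *)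
Definition dirichlet_sol (R : realType) (nu rho : R) (psi : R -> R[i])
    (u : R * R -> R[i]) : Prop :=
  [/\ C2_on (annulus rho) (fun p => complex.Re (u p)) /\
      C2_on (annulus rho) (fun p => complex.Im (u p)),
      forall p, annulus rho p -> AB_hamiltonian nu u p = 0,
      Hnorm2 2^-1 (fun m => fourier (on_circle u r) m - fourier psi m)
        @[r --> (1 : R)^'-] --> 0%E &
      Hnorm2 2^-1 (fourier (on_circle u r)) @[r --> rho^'+] --> 0%E].

(* Graph of the partial Dirichlet-to-Neumann operator
   H^(1/2)(S^1) -> H^(-1/2)(S^1); elements of H^(-1/2)(S^1), which need not be
   functions, are given by their Fourier coefficients. *)
Definition DN_graph (R : realType) (nu rho : R) (psi : R -> R[i])
    (c : int -> R[i]) : Prop :=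
  inHhalf psi /\
  exists u, dirichlet_sol nu rho psi u /\
    Hnorm2 (- 2^-1) (fun m => fourier (radial_derive u r) m - c m)
      @[r --> (1 : R)^'-] --> 0%E.

(* Graph of its realization as an unbounded operator in L^2(S^1). *)
Definition DN (R : realType) (nu rho : R) (psi phi : R -> R[i]) : Prop :=
  inL2 phi /\ DN_graph nu rho psi (fourier phi).

(* T is e^(-t M), where the unbounded operator with graph M is diagonalized by an
   orthonormal basis: T f = \sum_k e^(-t lam_k) <f, e_k> e_k in L^2. *)
Definition is_semigroup_op (R : realType)
    (M : (R -> R[i]) -> (R -> R[i]) -> Prop) (t : R)
    (T : (R -> R[i]) -> R -> R[i]) : Prop :=
  exists (e : nat -> R -> R[i]) (lam : nat -> R),
    [/\ orthonormal_basis e,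
        forall k, M (e k) (fun x => (lam k)%:C * e k x) &
        forall f, inL2 f -> inL2 (T f) /\
          L2cvg (fun n x =>
            \sum_(k < n) (expR (- t * lam k))%:C * L2dot f (e k) * e k x) (T f)].

(* T is trace class with trace s: convergence in every orthonormal basis. *)
Definition has_trace (R : realType) (T : (R -> R[i]) -> R -> R[i]) (s : R) :
    Prop :=
  forall e : nat -> R -> R[i], orthonormal_basis e ->
    (fun n => complex.Re (\sum_(k < n) L2dot (T (e k)) (e k))) @ \oo --> s /\
    (fun n => complex.Im (\sum_(k < n) L2dot (T (e k)) (e k))) @ \oo --> (0 : R).

Definition is_heat_trace (R : realType)
    (M : (R -> R[i]) -> (R -> R[i]) -> Prop) (t s : R) : Prop :=
  exists2 T, is_semigroup_op M t T & has_trace T s.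

(* |m - nu| (coth (a |m - nu|) - 1), continued by its limit 1 / a at m = nu. *)
Definition coth_defect (R : realType) (a nu : R) (m : int) : R :=
  if m%:~R == nu then a^-1
  else `|m%:~R - nu| * (coth (a * `|m%:~R - nu|) - 1).

(* Main.v *)
(* The functions e_m = e^(i m x) / sqrt (2 pi) form an orthonormal basis of
   L^2(S^1), and separation of variables diagonalizes the Dirichlet-to-Neumann
   operator in it: u = (al r^d + be r^(-d)) e^(i m x) with d = m - nu (a logarithm
   when d = 0) solves H u = 0, and the boundary conditions give the eigenvalue
   d coth (a d) = |m - nu| + coth_defect a nu m.  The sum of the e^(- t |m - nu|)
   is geometric and gives cosh / sinh.  The defects decay exponentially in |m|,
   so that the difference of the two heat traces may be expanded in powers of t
   termwise, the remainders of the exponential series being controlled uniformly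
   in m by the mean value theorem.  Completeness of the basis: polynomials in cosines
   converge boundedly to indicators of arcs, hence by Dynkin's lemma and dominated
   convergence the L^2 closure of the trigonometric polynomials is everything. *)
Require Import Defs.
From mathcomp Require Import all_boot all_order all_algebra.
From mathcomp Require Import all_classical all_reals all_analysis.
From mathcomp Require Import finmap measurable_realfun ring lra.

Set Implicit Arguments.
Unset Strict Implicit.
Unset Printing Implicit Defensive.

Import Order.TTheory GRing.Theory Num.Theory numFieldNormedType.Exports.

Local Open Scope classical_set_scope.
Local Open Scope ring_scope.
Local Open Scope complex_scope.

(** * Square-integrable functions on the circle *)

(** The trace has to come out the same in every orthonormal basis e. It becomes a double series of
    the nonnegative terms w_m |<e_k, phi_m>|^2, with phi the Fourier basis and w_m = e^(-t
    lambda_m); the order of summation may be exchanged, and Parseval's identity makes the sum over k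
    equal to w_m. The semigroup must also be a map between actual functions: the Fourier modes have
    a common bound and the weights are summable, so its values are pointwise limits. The Hamiltonian
    is given by Cartesian derivatives, so the separated solutions are built from |z|^(2 s) z^n and
    its conjugate with n = |m|, which avoids choosing an argument; 2 s + n must be d or - d. The
    constants come from weighing powers of lambda against the decay e^(- a |m - nu| / 2) of the
    defects. The bound x^N / N! <= 2^(-N) e^(2 x) at x = t lambda costs e^(2 t lambda), which t <= a
    / 8 keeps within half of that decay, while 2^(-N) sends the remainders to 0. The power series
    then telescopes: each monomial is a difference of consecutive remainder sums. *)

Section SquareIntegrable.
Context {R : realType}.
Notation mu := (@lebesgue_measure R).
Notation D := (@circle R).
Notation Re := (@complex.Re R).
Notation Im := (@complex.Im R).
Implicit Types (u v : R -> R) (f g h : R -> R[i]) (z c : R[i]).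

Lemma measurable_circle : @measurable _ (measurableTypeR R) D.
Proof. exact: measurable_itv. Qed.
Hint Resolve measurable_circle : core.

Lemma cReD z c : Re (z + c) = Re z + Re c. Proof. by case: z; case: c. Qed.
Lemma cImD z c : Im (z + c) = Im z + Im c. Proof. by case: z; case: c. Qed.
Lemma cReN z : Re (- z) = - Re z. Proof. by case: z. Qed.
Lemma cImN z : Im (- z) = - Im z. Proof. by case: z. Qed.
Lemma cReM z c : Re (z * c) = Re z * Re c - Im z * Im c.
Proof. by case: z; case: c. Qed.
Lemma cImM z c : Im (z * c) = Re z * Im c + Im z * Re c.
Proof. by case: z; case: c. Qed.
Lemma cReJ z : Re (conjc z) = Re z. Proof. by case: z. Qed.
Lemma cImJ z : Im (conjc z) = - Im z. Proof. by case: z. Qed.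
Definition ReImE := (cReD, cImD, cReN, cImN, cReM, cImM, cReJ, cImJ).

Lemma complex_ext z c : Re z = Re c -> Im z = Im c -> z = c.
Proof. by case: z; case: c => /= ? ? ? ? -> ->. Qed.

Lemma sqmod_ge0 z : 0 <= sqmod z.
Proof. by rewrite addr_ge0 ?sqr_ge0. Qed.

Lemma sqmodM z c : sqmod (z * c) = sqmod z * sqmod c.
Proof. by rewrite /sqmod !ReImE; ring. Qed.

(* lebesgue_measure lives on measurableTypeR R, whose display differs from that of
   the canonical structure on R; the measurable sets are convertible. *)
Notation measurable_on := (@measurable_fun _ _ (measurableTypeR R) _ D).

Definition square_integrable u :=
  measurable_on u /\ mu.-integrable D (EFin \o (fun x => u x ^+ 2)).

Lemma integrable_EFinD u v : mu.-integrable D (EFin \o u) ->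
  mu.-integrable D (EFin \o v) -> mu.-integrable D (EFin \o (fun x => u x + v x)).
Proof. by move=> iu iv; have := integrableD measurable_circle iu iv. Qed.

Lemma integrable_EFinZ r u : mu.-integrable D (EFin \o u) ->
  mu.-integrable D (EFin \o (fun x => r * u x)).
Proof. by move=> iu; have := integrableZl measurable_circle r iu. Qed.

Lemma integrable_EFinB u v : mu.-integrable D (EFin \o u) ->
  mu.-integrable D (EFin \o v) -> mu.-integrable D (EFin \o (fun x => u x - v x)).
Proof. by move=> iu iv; have := integrableB measurable_circle iu iv. Qed.

Lemma integrable_dominated u v : measurable_on u ->
  mu.-integrable D (EFin \o v) -> (forall x, D x -> `|u x| <= v x) ->
  mu.-integrable D (EFin \o u).
Proof.
move=> mu_ iv uv; apply: le_integrable iv => //; first exact/measurable_EFinP.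
by move=> x Dx /=; rewrite lee_fin (le_trans (uv x Dx))// ler_norm.
Qed.

(** The product is dominated by u^2 + v^2, because the squares of u - v and u + v are
    nonnegative. *)
Lemma square_integrableM u v : square_integrable u -> square_integrable v ->
  mu.-integrable D (EFin \o (fun x => u x * v x)).
Proof.
move=> [mu_ iu] [mv iv]; apply: integrable_dominated (integrable_EFinD iu iv) _.
  exact: measurable_funM.
move=> x _; rewrite ler_norml.
by have := sqr_ge0 (u x - v x); have := sqr_ge0 (u x + v x); lra.
Qed.

Lemma square_integrableZ r u : square_integrable u ->
  square_integrable (fun x => r * u x).
Proof.
move=> [mu_ iu]; split; first exact: measurable_funM.
have := integrable_EFinZ (r ^+ 2) iu.
by congr (_ .-integrable _ _); apply/funext => x /=; rewrite exprMn.
Qed.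

Lemma square_integrableD u v : square_integrable u -> square_integrable v ->
  square_integrable (fun x => u x + v x).
Proof.
move=> su sv; have iuv := square_integrableM su sv.
move: su sv => [mu_ iu] [mv iv]; split; first exact: measurable_funD.
have := integrable_EFinD (integrable_EFinD iu iv) (integrable_EFinZ 2 iuv).
by congr (_ .-integrable _ _); apply/funext => x /=; congr EFin; ring.
Qed.

Lemma integrable_ge0_lty u : measurable_on u -> (forall x, 0 <= u x) ->
  (\int[mu]_(x in D) (u x)%:E < +oo)%E -> mu.-integrable D (EFin \o u).
Proof.
move=> mu_ u0 uy; apply/integrableP; split; first exact/measurable_EFinP.
by under eq_integral => x _ do rewrite /= (ger0_norm (u0 x)).
Qed.

(** The squares of the two components are each dominated by the squared modulus and add up to it.
    This moves [inL2] from an extended-real integral to real integrability, where linearity is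
    available. *)
Lemma inL2P f : inL2 f <->
  square_integrable (fun x => Re (f x)) /\ square_integrable (fun x => Im (f x)).
Proof.
split=> [[mr mi fy]|[[mr ir] [mi ii]]].
  have mm : measurable_on (fun x => sqmod (f x)).
    by apply: measurable_funD; exact: measurable_funX.
  have im : mu.-integrable D (EFin \o (fun x => sqmod (f x))).
    by apply: integrable_ge0_lty => // x; exact: sqmod_ge0.
  split; split=> //; (apply: integrable_dominated im _; first exact: measurable_funX).
    by move=> x _; rewrite ger0_norm ?sqr_ge0// lerDl sqr_ge0.
  by move=> x _; rewrite ger0_norm ?sqr_ge0// lerDr sqr_ge0.
split=> //; have /integrableP[_] := integrable_EFinD ir ii.
rewrite /L2norm2; under eq_integral => x _ do
  rewrite /= ger0_norm ?addr_ge0 ?sqr_ge0//.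
by [].
Qed.

Lemma inL2_add f g : inL2 f -> inL2 g -> inL2 (fun x => f x + g x).
Proof.
move=> /inL2P[fr fi] /inL2P[gr gi]; apply/inL2P; split.
  by under eq_fun do rewrite cReD; exact: square_integrableD.
by under eq_fun do rewrite cImD; exact: square_integrableD.
Qed.

Lemma inL2_scale c f : inL2 f -> inL2 (fun x => c * f x).
Proof.
move=> /inL2P[fr fi]; apply/inL2P; split.
  under eq_fun do rewrite cReM -mulNr.
  by apply: square_integrableD; exact: square_integrableZ.
under eq_fun do rewrite cImM.
by apply: square_integrableD; exact: square_integrableZ.
Qed.

Lemma inL2_opp f : inL2 f -> inL2 (fun x => - f x).
Proof. by move=> /(inL2_scale (-1)); under eq_fun do rewrite mulN1r. Qed.

Lemma inL2_sub f g : inL2 f -> inL2 g -> inL2 (fun x => f x - g x).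
Proof. by move=> fL gL; apply: inL2_add => //; exact: inL2_opp. Qed.

Lemma inL2_0 : inL2 (fun=> 0 : R[i]).
Proof.
split; [exact: measurable_cst|exact: measurable_cst|].
rewrite /L2norm2; under eq_integral => x _ do rewrite /sqmod expr0n addr0.
by rewrite integral0.
Qed.

Lemma inL2_sum (F : nat -> R -> R[i]) n : (forall k, inL2 (F k)) ->
  inL2 (fun x => \sum_(k < n) F k x).
Proof.
move=> FL; elim: n => [|n IH].
  by under eq_fun do rewrite big_ord0; exact: inL2_0.
by under eq_fun do rewrite big_ord_recr /=; exact: inL2_add.
Qed.

Notation I := (Rintegral mu D).

Lemma L2dotE f g : L2dot f g =
  I (fun x => Re (f x) * Re (g x) + Im (f x) * Im (g x)) +i*
  I (fun x => Im (f x) * Re (g x) - Re (f x) * Im (g x)).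
Proof.
rewrite /L2dot /circle_int; congr Complex; apply: eq_Rintegral => x _.
  by rewrite !ReImE; ring.
by rewrite !ReImE; ring.
Qed.

Lemma inL2_dot_re f g : inL2 f -> inL2 g -> mu.-integrable D
  (EFin \o (fun x => Re (f x) * Re (g x) + Im (f x) * Im (g x))).
Proof.
move=> /inL2P[fr fi] /inL2P[gr gi].
by apply: integrable_EFinD; exact: square_integrableM.
Qed.

Lemma inL2_dot_im f g : inL2 f -> inL2 g -> mu.-integrable D
  (EFin \o (fun x => Im (f x) * Re (g x) - Re (f x) * Im (g x))).
Proof.
move=> /inL2P[fr fi] /inL2P[gr gi].
by apply: integrable_EFinB; exact: square_integrableM.
Qed.

Lemma L2dotC f g : inL2 f -> inL2 g -> L2dot g f = conjc (L2dot f g).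
Proof.
move=> fL gL; rewrite !L2dotE /=; congr Complex.
  by apply: eq_Rintegral => x _; ring.
rewrite -mulN1r -RintegralZl//; last exact: inL2_dot_im.
by apply: eq_Rintegral => x _; ring.
Qed.

Lemma L2dotDl f g h : inL2 f -> inL2 g -> inL2 h ->
  L2dot (fun x => f x + g x) h = L2dot f h + L2dot g h.
Proof.
move=> fL gL hL; rewrite !L2dotE; apply: complex_ext => /=.
  rewrite -RintegralD//; [|exact: inL2_dot_re..].
  by apply: eq_Rintegral => x _; rewrite !ReImE; ring.
rewrite -RintegralD//; [|exact: inL2_dot_im..].
by apply: eq_Rintegral => x _; rewrite !ReImE; ring.
Qed.

Lemma L2dotZl c f g : inL2 f -> inL2 g ->
  L2dot (fun x => c * f x) g = c * L2dot f g.
Proof.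
move=> fL gL; rewrite !L2dotE; apply: complex_ext; rewrite !ReImE /=.
  rewrite -!RintegralZl//; [|exact: inL2_dot_im|exact: inL2_dot_re].
  rewrite -RintegralB//; first by apply: eq_Rintegral => x _; rewrite !ReImE; ring.
    by apply: integrable_EFinZ; exact: inL2_dot_re.
  by apply: integrable_EFinZ; exact: inL2_dot_im.
rewrite -!RintegralZl//; [|exact: inL2_dot_re|exact: inL2_dot_im].
rewrite -RintegralD//; first by apply: eq_Rintegral => x _; rewrite !ReImE; ring.
  by apply: integrable_EFinZ; exact: inL2_dot_im.
by apply: integrable_EFinZ; exact: inL2_dot_re.
Qed.

Lemma L2dot0l g : L2dot (fun=> 0) g = 0.
Proof.
by rewrite L2dotE; apply: complex_ext => /=;
  under eq_Rintegral => x _ do rewrite !mul0r ?addr0 ?subrr;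
  rewrite Rintegral_cst// mul0r.
Qed.

Lemma L2dotNl f g : inL2 f -> inL2 g -> L2dot (fun x => - f x) g = - L2dot f g.
Proof.
move=> fL gL; have := L2dotZl (-1) fL gL; rewrite mulN1r.
by under eq_fun do rewrite mulN1r.
Qed.

Lemma L2dotBl f g h : inL2 f -> inL2 g -> inL2 h ->
  L2dot (fun x => f x - g x) h = L2dot f h - L2dot g h.
Proof. by move=> fL gL hL; rewrite L2dotDl ?L2dotNl//; exact: inL2_opp. Qed.

Lemma L2dotZr c f g : inL2 f -> inL2 g ->
  L2dot f (fun x => c * g x) = conjc c * L2dot f g.
Proof.
move=> fL gL; rewrite L2dotC ?L2dotZl ?rmorphM//; [|exact: inL2_scale].
by rewrite (L2dotC gL fL).
Qed.

Lemma L2dotBr f g h : inL2 f -> inL2 g -> inL2 h ->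
  L2dot f (fun x => g x - h x) = L2dot f g - L2dot f h.
Proof.
move=> fL gL hL; rewrite L2dotC ?L2dotBl ?rmorphB//; [|exact: inL2_sub].
by rewrite (L2dotC gL fL) (L2dotC hL fL).
Qed.

Lemma L2dot_suml (F : nat -> R -> R[i]) n h : (forall k, inL2 (F k)) -> inL2 h ->
  L2dot (fun x => \sum_(k < n) F k x) h = \sum_(k < n) L2dot (F k) h.
Proof.
move=> FL hL; elim: n => [|n IH].
  by under eq_fun do rewrite big_ord0; rewrite big_ord0 L2dot0l.
under eq_fun do rewrite big_ord_recr /=.
by rewrite big_ord_recr /= L2dotDl// ?IH//; exact: inL2_sum.
Qed.

Definition L2sq f := Re (L2dot f f).

Lemma L2norm2E f : inL2 f -> L2norm2 f = (L2sq f)%:E.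
Proof.
move=> fL; rewrite /L2sq L2dotE /= /L2norm2 /Rintegral fineK; last first.
  apply: integrable_fin_num => //; exact: inL2_dot_re.
by apply: eq_integral => x _; rewrite /sqmod !expr2.
Qed.

Lemma Im_L2dot_self f : inL2 f -> Im (L2dot f f) = 0.
Proof. by move=> fL; have := congr1 Im (L2dotC fL fL); rewrite cImJ; lra. Qed.

Lemma L2sq_ge0 f : 0 <= L2sq f.
Proof.
by rewrite /L2sq L2dotE; apply: Rintegral_ge0 => x _; rewrite -!expr2 addr_ge0 ?sqr_ge0.
Qed.

Lemma L2sqZ c f : inL2 f -> L2sq (fun x => c * f x) = sqmod c * L2sq f.
Proof.
move=> fL; rewrite /L2sq L2dotZl ?L2dotZr//; last exact: inL2_scale.
by rewrite !ReImE Im_L2dot_self// /sqmod; ring.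
Qed.

Lemma L2sqB f g : inL2 f -> inL2 g ->
  L2sq (fun x => f x - g x) = L2sq f - 2 * Re (L2dot f g) + L2sq g.
Proof.
move=> fL gL; rewrite /L2sq L2dotBl ?L2dotBr//; [|exact: inL2_sub].
by rewrite (L2dotC fL gL) !ReImE; ring.
Qed.

Lemma L2sq_sub_le f g : inL2 f -> inL2 g ->
  L2sq (fun x => f x - g x) <= 2 * L2sq f + 2 * L2sq g.
Proof.
(* Nonnegativity of the squared norm of f + g bounds the cross term in that of f - g. *)
move=> fL gL; have := L2sq_ge0 (fun x => f x - (-1) * g x).
rewrite !L2sqB//; last exact: inL2_scale.
by rewrite L2dotZr// L2sqZ// !ReImE /sqmod /=; nra.
Qed.

(* L2sq (f - r <f, g> g) >= 0 for all real r; the optimal r is 1 / L2sq g. *)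
Lemma cauchy_schwarz f g : inL2 f -> inL2 g ->
  sqmod (L2dot f g) <= L2sq f * L2sq g.
Proof.
move=> fL gL; set c := L2dot f g; set s := L2sq g.
have sg0 : 0 <= s by exact: L2sq_ge0.
have key r : 0 <= L2sq f - 2 * r * sqmod c + r ^+ 2 * sqmod c * s.
  have := L2sq_ge0 (fun x => f x - (r%:C * c) * g x).
  rewrite L2sqB//; last exact: inL2_scale.
  rewrite L2dotZr// -/c L2sqZ// -/s sqmodM !ReImE /sqmod /= => /le_trans; apply.
  by rewrite le_eqVlt; apply/orP; left; apply/eqP; ring.
have c0 := sqmod_ge0 c.
have [s0|s0] := eqVneq s 0; last first.
  have sp : 0 < s by rewrite lt_def s0.
  have := key s^-1; rewrite exprVn.
  have -> : L2sq f - 2 * s^-1 * sqmod c + s ^- 2 * sqmod c * s =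
    L2sq f - sqmod c / s by field.
  by rewrite subr_ge0 ler_pdivrMr.
(* In the degenerate case the inequality is affine in r, and the r chosen next makes its right-hand
   side equal to - 1. *)
rewrite s0 mulr0 leNgt; apply/negP => cp.
have := key ((L2sq f + 1) / (2 * sqmod c)); rewrite s0 mulr0 addr0.
have -> : 2 * ((L2sq f + 1) / (2 * sqmod c)) * sqmod c = L2sq f + 1.
  by field; rewrite gt_eqF.
lra.
Qed.

End SquareIntegrable.

(** * Projections on orthonormal sequences, closed spans and Parseval's identity *)

Section Orthonormal.
Context {R : realType}.
Notation mu := (@lebesgue_measure R).
Notation D := (@circle R).
Notation Re := (@complex.Re R).
Notation Im := (@complex.Im R).
Notation measurable_on := (@measurable_fun _ _ (measurableTypeR R) _ D).
Implicit Types (u v : R -> R) (f g h : R -> R[i]) (z c : R[i])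
  (e : nat -> R -> R[i]).
Hint Resolve measurable_circle : core.

Lemma cvg_seqZ (c : R) (u : nat -> R) l :
  u @ \oo --> l -> (fun n => c * u n) @ \oo --> c * l.
Proof. by move=> ul; apply: cvgM => //; exact: cvg_cst. Qed.

Lemma cvg0_eps (u : nat -> R) : (forall n, 0 <= u n) ->
  (forall eps, 0 < eps -> exists2 v : nat -> R,
    v @ \oo --> (0 : R) & forall n, u n <= eps + v n) ->
  u @ \oo --> (0 : R).
Proof.
move=> u0 h; apply/cvgrPdist_lt => eps eps0.
have [v /cvgrPdist_lt vc uv] := h _ (divr_gt0 eps0 (ltr0Sn _ 1)).
have [N _ vN] := vc _ (divr_gt0 eps0 (ltr0Sn _ 1)).
exists N => // n /vN /=; rewrite !sub0r !normrN (ger0_norm (u0 n)) => vn.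
have := uv n; have := ler_norm (v n); lra.
Qed.

Lemma L2_dominated_cvg (F : nat -> R -> R[i]) f (B : R -> R) :
  (forall n, inL2 (F n)) -> inL2 f -> mu.-integrable D (EFin \o B) ->
  (forall n x, D x -> sqmod (F n x - f x) <= B x) ->
  (forall x, D x -> (fun n => Re (F n x)) @ \oo --> Re (f x)) ->
  (forall x, D x -> (fun n => Im (F n x)) @ \oo --> Im (f x)) ->
  (fun n => L2sq (fun x => F n x - f x)) @ \oo --> (0 : R).
Proof.
move=> FL fL iB FB Fre Fim.
have FfL n : inL2 (fun x => F n x - f x) by exact: inL2_sub.
suff : (fun n => L2norm2 (fun x => F n x - f x)) @ \oo --> 0%E.
  by under eq_fun do rewrite L2norm2E//; move/fine_cvg.
have [] := @dominated_convergence _ _ _ mu D measurable_circle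
  (fun n x => (sqmod (F n x - f x))%:E) (cst 0%E) (EFin \o B).
- move=> n; apply/measurable_EFinP.
  by have [? ? _] := FfL n; apply: measurable_funD; exact: measurable_funX.
- exact: measurable_cst.
- apply/aeW => x Dx; apply/fine_cvgP; split; first exact: nearW.
  rewrite /= /comp/= /sqmod.
  (* The limit 0 is written as the squared modulus evaluated at the limit, so that the limit rules
     for sums and products apply. *)
  have -> : (0 : R) = (Re (f x) - Re (f x)) ^+ 2 + (Im (f x) - Im (f x)) ^+ 2.
    by rewrite !subrr expr0n addr0.
  under eq_fun do rewrite !ReImE.
  rewrite !expr2; under eq_fun do rewrite !expr2.
  by apply: cvgD; apply: cvgM; apply: cvgB;
    (exact: cvg_cst || exact: Fre || exact: Fim).
- exact: iB.
- by apply/aeW => x n Dx; rewrite /= lee_fin ger0_norm ?sqmod_ge0// FB.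
move=> _ _; rewrite integral0.
by [].
Qed.

Lemma integrable_circle_cst (B : R) : mu.-integrable D (EFin \o (fun=> B)).
Proof.
apply: measurable_bounded_integrable => //.
- have /= := lebesgue_measure_itv `[(0 : R), 2 * pi]; rewrite -/(@circle R).
  by case: ifP => _ ->; rewrite // -EFinD ltry.
- exists `|B|; split; first exact: normr_real.
  by move=> M BM x _; exact: ltW.
Qed.

Lemma inL2_bounded f (B : R) : measurable_on (fun x => Re (f x)) ->
  measurable_on (fun x => Im (f x)) -> (forall x, D x -> sqmod (f x) <= B) ->
  inL2 f.
Proof.
move=> mr mi fB.
have iB := integrable_circle_cst B.
apply/inL2P; split; split=> //.
  apply: (integrable_dominated _ iB) => [|x /fB]; first exact: measurable_funX.
  by apply: le_trans; rewrite ger0_norm ?sqr_ge0// lerDl sqr_ge0.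
apply: (integrable_dominated _ iB) => [|x /fB]; first exact: measurable_funX.
by apply: le_trans; rewrite ger0_norm ?sqr_ge0// lerDr sqr_ge0.
Qed.

(** This is [orthonormal_basis] without completeness, so that projections can be used to prove the
    completeness of the Fourier basis. *)
Definition orthonormal_seq e :=
  (forall k, inL2 (e k)) /\ forall j k, L2dot (e j) (e k) = (j == k)%:R.

Lemma L2sq_orthonormal_seq e k : orthonormal_seq e -> L2sq (e k) = 1.
Proof. by move=> [_ eo]; rewrite /L2sq eo eqxx. Qed.

Definition orth_proj e f n : R -> R[i] :=
  fun x => \sum_(k < n) L2dot f (e k) * e k x.

Lemma proj_inL2 e f n : orthonormal_seq e -> inL2 (orth_proj e f n).
Proof.
move=> [eL _];
apply: (@inL2_sum _ (fun k x => L2dot f (e k) * e k x)) => k.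
exact: inL2_scale.
Qed.

Lemma L2dot_proj e f n j : orthonormal_seq e ->
  L2dot (orth_proj e f n) (e j) = if (j < n)%N then L2dot f (e j) else 0.
Proof.
move=> [eL eo]; rewrite (@L2dot_suml _ (fun k x => L2dot f (e k) * e k x))//; last first.
  by move=> k; exact: inL2_scale.
under eq_bigr => k _ do rewrite L2dotZl// eo.
case: ifPn => [jn|nj].
  rewrite (bigD1 (Ordinal jn))//= eqxx mulr1 big1 ?addr0// => k.
  by rewrite -val_eqE /= => /negPf ->; rewrite mulr0.
rewrite big1// => k _; case: eqP => [kj|]; last by rewrite mulr0.
by rewrite -kj ltn_ord in nj.
Qed.

Lemma proj_recr e f n x :
  orth_proj e f n.+1 x = orth_proj e f n x + L2dot f (e n) * e n x.
Proof. by rewrite /orth_proj big_ord_recr. Qed.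

(** Pythagoras, one vector at a time: the residual after n steps has the same coefficient along e_n
    as f, since the projection has none there. *)
Lemma L2sq_sub_proj e f n : orthonormal_seq e -> inL2 f ->
  L2sq (fun x => f x - orth_proj e f n x) =
  L2sq f - \sum_(k < n) sqmod (L2dot f (e k)).
Proof.
move=> oe fL; have [eL eo] := oe; elim: n => [|n IH].
  by rewrite /orth_proj big_ord0 subr0; congr L2sq; apply/funext => x;
    rewrite big_ord0 subr0.
rewrite big_ord_recr /= opprD addrA -IH.
under eq_fun do rewrite proj_recr opprD addrA.
have rL := inL2_sub fL (proj_inL2 f n oe).
rewrite (L2sqB rL (inL2_scale (L2dot f (e n)) (eL n))).
rewrite L2dotZr// L2dotBl// ?L2dot_proj//; last exact: proj_inL2.
by rewrite ltnn subr0 L2sqZ// L2sq_orthonormal_seq// !ReImE /sqmod; ring.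
Qed.

Lemma L2sq_sub_proj_le e f n : orthonormal_seq e -> inL2 f ->
  L2sq (fun x => f x - orth_proj e f n x) <= L2sq f.
Proof.
move=> oe fL; rewrite L2sq_sub_proj// lerBlDr lerDl sumr_ge0// => k _.
exact: sqmod_ge0.
Qed.

(** The closed linear span of e. Completeness amounts to every square-integrable function being
    reached. *)
Definition reached e f :=
  inL2 f /\ (fun n => L2sq (fun x => f x - orth_proj e f n x)) @ \oo --> (0 : R).

Lemma projD e f g n x : orthonormal_seq e -> inL2 f -> inL2 g ->
  orth_proj e (fun x => f x + g x) n x = orth_proj e f n x + orth_proj e g n x.
Proof.
move=> [eL _] fL gL; rewrite -big_split /=.
by apply: eq_bigr => k _; rewrite L2dotDl// mulrDl.
Qed.

Lemma projZ e c f n x : orthonormal_seq e -> inL2 f ->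
  orth_proj e (fun x => c * f x) n x = c * orth_proj e f n x.
Proof.
move=> [eL _] fL; rewrite mulr_sumr.
by apply: eq_bigr => k _; rewrite L2dotZl// mulrA.
Qed.

Lemma L2sq_add_le f g : inL2 f -> inL2 g ->
  L2sq (fun x => f x + g x) <= 2 * L2sq f + 2 * L2sq g.
Proof.
move=> fL gL; have := L2sq_sub_le fL (inL2_scale (-1) gL).
rewrite L2sqZ// (_ : sqmod (-1) = 1) ?mul1r; last first.
  by rewrite /sqmod cReN cImN /= oppr0 expr0n sqrrN expr1n addr0.
by under eq_fun do rewrite mulN1r opprK.
Qed.

Lemma reachedD e f g : orthonormal_seq e -> reached e f -> reached e g ->
  reached e (fun x => f x + g x).
Proof.
move=> oe [fL fc] [gL gc]; split; first exact: inL2_add.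
apply: (@squeeze_cvgr _ _ _ _ (cst 0)
  (fun n => 2 * L2sq (fun x => f x - orth_proj e f n x) +
            2 * L2sq (fun x => g x - orth_proj e g n x))).
- apply: nearW => n; rewrite L2sq_ge0/=.
  apply: le_trans (L2sq_add_le (inL2_sub fL (proj_inL2 f n oe))
    (inL2_sub gL (proj_inL2 g n oe))).
  rewrite le_eqVlt; apply/orP; left; apply/eqP; congr L2sq.
  by apply/funext => x; rewrite projD//; ring.
- exact: cvg_cst.
- by have := cvgD (@cvg_seqZ 2 _ _ fc) (@cvg_seqZ 2 _ _ gc); rewrite mulr0 addr0; exact.
Qed.

Lemma reachedZ e c f : orthonormal_seq e -> reached e f -> reached e (fun x => c * f x).
Proof.
move=> oe [fL fc]; split; first exact: inL2_scale.
have -> : (fun n => L2sq (fun x => c * f x - orth_proj e (fun x => c * f x) n x)) =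
    (fun n => sqmod c * L2sq (fun x => f x - orth_proj e f n x)).
  apply/funext => n; rewrite -L2sqZ//; last by apply: inL2_sub => //; exact: proj_inL2.
  by congr L2sq; apply/funext => x; rewrite projZ//; ring.
by have := @cvg_seqZ (sqmod c) _ _ fc; rewrite mulr0; exact.
Qed.

Lemma reachedB e f g : orthonormal_seq e -> reached e f -> reached e g ->
  reached e (fun x => f x - g x).
Proof.
move=> oe rf /(reachedZ (-1) oe); under eq_fun do rewrite mulN1r.
exact: reachedD.
Qed.

(** Taking the residual is linear and does not increase the norm, so the residual of f splits into
    that of f - g, controlled by the distance of f and g, and that of g, which tends to 0. The
    approximation is used within eps / 2 because of the factor 2 in [L2sq_add_le]. *)
Lemma reached_closed e f : orthonormal_seq e -> inL2 f ->
  (forall eps : R, 0 < eps -> exists2 g, reached e g &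
     L2sq (fun x => f x - g x) < eps) ->
  reached e f.
Proof.
move=> oe fL fap; split=> //; apply: cvg0_eps => [n|eps eps0].
  exact: L2sq_ge0.
have [g [gL gc] fg] := fap (eps / 2) (divr_gt0 eps0 (ltr0Sn _ 1)).
exists (fun n => 2 * L2sq (fun x => g x - orth_proj e g n x)).
  by have := @cvg_seqZ 2 _ _ gc; rewrite mulr0; exact.
move=> n; have fgL := inL2_sub fL gL.
have h1 := L2sq_add_le (inL2_sub fgL (proj_inL2 (fun x => f x - g x) n oe))
  (inL2_sub gL (proj_inL2 g n oe)).
have h2 := L2sq_sub_proj_le n oe fgL.
have h3 : (fun x => f x - orth_proj e f n x) = (fun x =>
    (f x - g x - orth_proj e (fun x => f x - g x) n x) + (g x - orth_proj e g n x)).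
  apply/funext => x; have := @projD e (fun x => f x - g x) g n x oe fgL gL.
  by under [X in orth_proj _ X]eq_fun do rewrite subrK; move=> ->; ring.
rewrite h3; apply: le_trans h1 _; rewrite lerD2r.
apply: (@le_trans _ _ (2 * (eps / 2))); last by rewrite mulrC divfK.
by rewrite ler_pM2l//; apply: le_trans h2 (ltW fg).
Qed.

Lemma reached_cvg e (F : nat -> R -> R[i]) f : orthonormal_seq e ->
  (forall n, reached e (F n)) -> inL2 f ->
  (fun n => L2sq (fun x => F n x - f x)) @ \oo --> (0 : R) -> reached e f.
Proof.
move=> oe Fr fL Fc; apply: reached_closed => // eps eps0.
move/cvgrPdist_lt : Fc => /(_ _ eps0)[N _ /(_ N (leqnn N))]/=.
rewrite sub0r normrN ger0_norm ?L2sq_ge0// => h; exists (F N) => //.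
have [FL _] := Fr N.
suff -> : L2sq (fun x => f x - F N x) = L2sq (fun x => F N x - f x) by [].
rewrite -[RHS]mul1r -(_ : sqmod (-1) = 1); last first.
  by rewrite /sqmod cReN cImN /= oppr0 expr0n sqrrN expr1n addr0.
rewrite -L2sqZ; last exact: inL2_sub.
by congr L2sq; apply/funext => x; ring.
Qed.

Lemma reached_self e j : orthonormal_seq e -> reached e (e j).
Proof.
move=> oe; have [eL eo] := oe; split=> //.
apply: cvg_near_cst; near=> n.
have jn : (j < n)%N by near: n; exact: nbhs_infty_gt.
rewrite L2sq_sub_proj// (bigD1 (Ordinal jn))//= big1 => [|k].
  by rewrite L2sq_orthonormal_seq// eo eqxx /sqmod /= expr1n expr0n /=; ring.
rewrite -val_eqE/= eq_sym eo => /negPf ->.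
by rewrite /sqmod expr0n addr0.
Unshelve. all: by end_near. Qed.

(** The identity that makes the trace independent of the basis; by [L2sq_sub_proj] it is
    completeness in another form. *)
Lemma parseval e f : orthonormal_basis e -> inL2 f ->
  (fun n => \sum_(k < n) sqmod (L2dot f (e k))) @ \oo --> L2sq f.
Proof.
move=> [eL eo ec] fL; have oe : orthonormal_seq e by split.
have := ec f fL; rewrite /L2cvg => h.
have {}h : (fun n => L2sq (fun x => f x - orth_proj e f n x)) @ \oo --> (0 : R).
  have -> : (fun n => L2sq (fun x => f x - orth_proj e f n x)) =
    fine \o (fun n => L2norm2 (fun x => orth_proj e f n x - f x)).
    apply/funext => n /=.
    rewrite L2norm2E; last by apply: inL2_sub => //; exact: proj_inL2.
    rewrite /= -[RHS]mul1r -(_ : sqmod (-1) = 1); last first.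
      by rewrite /sqmod cReN cImN /= oppr0 expr0n sqrrN expr1n addr0.
    rewrite -L2sqZ; last by apply: inL2_sub => //; exact: proj_inL2.
    by congr L2sq; apply/funext => x; ring.
  exact: fine_cvg.
have -> : (fun n => \sum_(k < n) sqmod (L2dot f (e k))) =
    (fun n => L2sq f - L2sq (fun x => f x - orth_proj e f n x)).
  by apply/funext => n; rewrite L2sq_sub_proj// opprB addrCA subrr addr0.
rewrite -[X in _ --> X]subr0.
by apply: cvgB => //; exact: cvg_cst.
Qed.

End Orthonormal.

(** * Completeness of the Fourier basis *)

Section FourierBasis.
Context {R : realType}.
Notation mu := (@lebesgue_measure R).
Notation D := (@circle R).
Notation Re := (@complex.Re R).
Notation Im := (@complex.Im R).
Notation measurable_on := (@measurable_fun _ _ (measurableTypeR R) _ D).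
Implicit Types (u v : R -> R) (f g h : R -> R[i]) (z c : R[i]) (m n : int).
Hint Resolve measurable_circle : core.

Lemma Rintegral_derive (F f : R -> R) (a b : R) : a < b ->
  (forall x : R, is_derive x 1 F (f x)) -> continuous f ->
  Rintegral mu `[a, b]%classic f = F b - F a.
Proof.
move=> ab dF cf.
have cF : continuous F.
  by move=> x; apply: differentiable_continuous; apply/derivable1_diffP; case: (dF x).
rewrite /Rintegral (@continuous_FTC2 _ f F a b) //.
- exact: continuous_subspaceT.
- split; first by move=> x _; case: (dF x).
    exact/cvg_at_right_filter/cF.
  exact/cvg_at_left_filter/cF.
- by move=> x _; rewrite derive1E; case: (dF x).
Qed.

Definition expi m : R -> R[i] :=
  fun x => cos (m%:~R * x) +i* sin (m%:~R * x).

Lemma expiM m n x : expi m x * expi n x = expi (m + n) x.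
Proof.
apply: complex_ext; rewrite !ReImE /= rmorphD /= mulrDl ?cosD ?sinD //.
by rewrite addrC; congr (_ + _); rewrite mulrC.
Qed.

Lemma conj_expi m x : conjc (expi m x) = expi (- m) x.
Proof.
by apply: complex_ext; rewrite !ReImE /= rmorphN /= mulNr ?cosN ?sinN.
Qed.

Lemma sin_int2pi m : sin (m%:~R * (2 * pi)) = 0 :> R.
Proof.
have -> : m%:~R * (2 * pi) = 0 + (pi *+ 2) *~ m :> R.
  by rewrite add0r mulrzl mulr_natl.
case: m => n; first by rewrite (periodicn (@sinD2pi R)) sin0.
by rewrite NegzE mulrNz add0r sinN -[_ *~ _]add0r (periodicn (@sinD2pi R)) sin0 oppr0.
Qed.

Lemma cos_int2pi m : cos (m%:~R * (2 * pi)) = 1 :> R.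
Proof.
have -> : m%:~R * (2 * pi) = 0 + (pi *+ 2) *~ m :> R.
  by rewrite add0r mulrzl mulr_natl.
case: m => n; first by rewrite (periodicn (@cosD2pi R)) cos0.
by rewrite NegzE mulrNz add0r cosN -[_ *~ _]add0r (periodicn (@cosD2pi R)) cos0.
Qed.

Lemma is_derive_sinM (k x : R) :
  is_derive x 1 (fun y => sin (k * y)) (k * cos (k * x)).
Proof.
have h : is_derive x 1 (fun y : R => k * y) k.
  by apply: is_derive_eq; rewrite ?scaler0 ?add0r ?addr0 [LHS]mulr1.
by have := is_derive1_comp (is_derive_sin (k * x)) h; rewrite mulrC.
Qed.

Lemma is_derive_cosM (k x : R) :
  is_derive x 1 (fun y => cos (k * y)) (- k * sin (k * x)).
Proof.
have h : is_derive x 1 (fun y : R => k * y) k.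
  by apply: is_derive_eq; rewrite ?scaler0 ?add0r ?addr0 [LHS]mulr1.
have := is_derive1_comp (is_derive_cos (k * x)) h.
by rewrite (_ : - sin (k * x) * k = - k * sin (k * x)); last by ring.
Qed.

Lemma continuous_cosM (k : R) : continuous (fun x => cos (k * x)).
Proof.
move=> x; apply: differentiable_continuous; apply/derivable1_diffP.
by case: (is_derive_cosM k x).
Qed.

Lemma continuous_sinM (k : R) : continuous (fun x => sin (k * x)).
Proof.
move=> x; apply: differentiable_continuous; apply/derivable1_diffP.
by case: (is_derive_sinM k x).
Qed.

Lemma circle_int_expi m :
  circle_int (expi m) = (if m == 0 then 2 * pi else 0)%:C.
Proof.
have pi2 : 0 < 2 * pi :> R by rewrite mulr_gt0 ?pi_gt0.
have cc (r : R) : continuous (fun _ : R => r) by move=> x; exact: cvg_cst.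
rewrite /circle_int /circle /expi /=; case: eqP => [->|/eqP m0].
  have d1 (x : R) : is_derive x 1 (@id R) 1 by exact: is_derive_id.
  have d0 (x : R) : is_derive x 1 (fun _ : R => 0 : R) 0 by exact: is_derive_cst.
  congr Complex.
    under eq_Rintegral => x _ do rewrite mul0r cos0.
    by rewrite (Rintegral_derive pi2 d1 (cc _)) subr0.
  under eq_Rintegral => x _ do rewrite mul0r sin0.
  by rewrite (Rintegral_derive pi2 d0 (cc _)) subrr.
have m0' : m%:~R != 0 :> R by rewrite intr_eq0.
have ds (x : R) :
    is_derive x 1 (fun x => m%:~R^-1 * sin (m%:~R * x)) (cos (m%:~R * x)).
  have h := is_derive_sinM m%:~R x; apply: is_derive_eq.
  by rewrite ?scaler0 ?add0r ?addr0 /= /GRing.scale /= mulrA mulVf// mul1r.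
have dc (x : R) :
    is_derive x 1 (fun x => - m%:~R^-1 * cos (m%:~R * x)) (sin (m%:~R * x)).
  have h := is_derive_cosM m%:~R x; apply: is_derive_eq.
  by rewrite ?scaler0 ?add0r ?addr0 /= /GRing.scale /= mulrA mulrNN mulVf// mul1r.
congr Complex.
  rewrite (Rintegral_derive pi2 ds (@continuous_cosM _)).
  by rewrite sin_int2pi !mulr0 sin0 mulr0 subr0.
rewrite (Rintegral_derive pi2 dc (@continuous_sinM _)).
by rewrite cos_int2pi !mulr0 cos0 subrr.
Qed.

Lemma measurable_on_continuous u : continuous u -> measurable_on u.
Proof.
by move=> cu; exact: measurable_funTS (continuous_measurable_fun cu).
Qed.

Lemma sqmod_expi m x : sqmod (expi m x) = 1.
Proof. by rewrite /sqmod /= cos2Dsin2. Qed.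

Lemma expi_inL2 m : inL2 (expi m).
Proof.
apply: (@inL2_bounded _ _ 1).
- by apply: measurable_on_continuous; exact: continuous_cosM.
- by apply: measurable_on_continuous; exact: continuous_sinM.
- by move=> x _; rewrite sqmod_expi.
Qed.

Lemma L2dot_expi m n :
  L2dot (expi m) (expi n) = (if m == n then 2 * pi else 0)%:C.
Proof.
rewrite /L2dot; under [X in circle_int X]eq_fun do rewrite conj_expi expiM.
by rewrite circle_int_expi subr_eq0.
Qed.

(* Enumerates the integers as 0, 1, -1, 2, -2, so that for 0 <= nu < 1 the values
   |mode k - nu| are j + nu at k = 2 j and j + 1 - nu at k = 2 j + 1. *)
Definition mode (k : nat) : int :=
  if odd k then (k./2.+1)%:Z else - (k./2)%:Z.

Definition mode_index m : nat :=
  match m with Posz 0 => 0 | Posz j.+1 => j.*2.+1 | Negz j => j.+1.*2 end.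

Lemma modeK : cancel mode mode_index.
Proof.
move=> k; rewrite /mode; have := odd_double_half k.
by case: (odd k) => /=; case: (k./2) => [|j] <-; rewrite ?oppr0 -?NegzE.
Qed.

Lemma mode_indexK : cancel mode_index mode.
Proof.
case=> [[|j]|j]; rewrite /mode_index /mode //= ?odd_double ?doubleK ?uphalf_double //=.
Qed.

Lemma sqrt2pi_gt0 : 0 < Num.sqrt (2 * pi) :> R.
Proof. by rewrite sqrtr_gt0 mulr_gt0 ?pi_gt0. Qed.

Definition fourier_basis (k : nat) : R -> R[i] :=
  fun x => ((Num.sqrt (2 * pi))^-1)%:C * expi (mode k) x.

Lemma fourier_basis_inL2 k : inL2 (fourier_basis k).
Proof. by apply: inL2_scale; exact: expi_inL2. Qed.

Lemma orthonormal_fourier_basis : orthonormal_seq fourier_basis.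
Proof.
split=> [|j k]; first exact: fourier_basis_inL2.
rewrite L2dotZl ?L2dotZr; [|exact: expi_inL2..|exact: fourier_basis_inL2].
rewrite conjc_real L2dot_expi (can_eq modeK).
case: eqP => _; last by rewrite !mulr0.
rewrite mulrA -!rmorphM /= -invfM -expr2 sqr_sqrtr; last first.
  by rewrite mulr_ge0 ?pi_ge0.
by rewrite mulVf ?gt_eqF// mulr_gt0 ?pi_gt0.
Qed.

(** The inductive form makes closure under products a structural induction on both factors, ending
    in [expiM]. *)
Inductive trigpoly : (R -> R[i]) -> Prop :=
| trigpoly_expi m : trigpoly (expi m)
| trigpolyD f g : trigpoly f -> trigpoly g -> trigpoly (fun x => f x + g x)
| trigpolyZ c f : trigpoly f -> trigpoly (fun x => c * f x).

Lemma reached_trigpoly f : trigpoly f -> reached fourier_basis f.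
Proof.
elim=> [m|{}f g _ fr _ gr|c {}f _ fr].
- have -> : expi m = fun x =>
      (Num.sqrt (2 * pi))%:C * fourier_basis (mode_index m) x.
    apply/funext => x; rewrite /fourier_basis mode_indexK mulrA -rmorphM /=.
    by rewrite divff ?gt_eqF ?sqrt2pi_gt0// mul1r.
  exact: reachedZ orthonormal_fourier_basis (reached_self _ orthonormal_fourier_basis).
- exact: reachedD orthonormal_fourier_basis fr gr.
- exact: reachedZ orthonormal_fourier_basis fr.
Qed.

Lemma trigpoly_cst c : trigpoly (fun=> c).
Proof.
have := trigpolyZ c (trigpoly_expi 0).
under eq_fun do rewrite /expi mul0r cos0 sin0 mulr1.
by [].
Qed.

Lemma trigpolyM f g : trigpoly f -> trigpoly g -> trigpoly (fun x => f x * g x).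
Proof.
move=> tf tg; elim: tf => [m|{}f h _ IHf _ IHh|c {}f _ IH].
- elim: tg => [n|{}f h _ IHf _ IHh|c {}f _ IH].
  + under eq_fun do rewrite expiM; exact: trigpoly_expi.
  + by under eq_fun do rewrite mulrDr; exact: trigpolyD.
  + by under eq_fun do rewrite mulrCA; exact: trigpolyZ.
- by under eq_fun do rewrite mulrDl; exact: trigpolyD.
- by under eq_fun do rewrite -mulrA; exact: trigpolyZ.
Qed.

Lemma trigpolyX f k : trigpoly f -> trigpoly (fun x => f x ^+ k).
Proof.
move=> tf; elim: k => [|k IH].
  by under eq_fun do rewrite expr0; exact: trigpoly_cst.
by under eq_fun do rewrite exprS; exact: trigpolyM.
Qed.

Lemma trigpoly_cosB (b : R) : trigpoly (fun x => (cos (x - b))%:C).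
Proof.
(* Euler's formula: the coefficients of e^(i x) and e^(- i x) in cos (x - b) are e^(- i b) / 2 and
   e^(i b) / 2. *)
have := trigpolyD (trigpolyZ (2^-1 * cos b -i* (2^-1 * sin b)) (trigpoly_expi 1))
  (trigpolyZ (2^-1 * cos b +i* (2^-1 * sin b)) (trigpoly_expi (-1))).
congr trigpoly; apply/funext => x; apply: complex_ext; rewrite !ReImE /=.
  by rewrite mul1r mulN1r cosN sinN cosB; field.
by rewrite mul1r mulN1r cosN sinN; ring.
Qed.

End FourierBasis.

(** * Indicators of arcs as limits of trigonometric polynomials *)

Section Density.
Context {R : realType}.
Notation mu := (@lebesgue_measure R).
Notation D := (@circle R).
Notation Re := (@complex.Re R).
Notation Im := (@complex.Im R).
Notation measurable_on := (@measurable_fun _ _ (measurableTypeR R) _ D).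
Notation mset := (@measurable _ (measurableTypeR R)).
Implicit Types (u v : R -> R) (f g h : R -> R[i]) (z c : R[i]) (n N : nat).
Hint Resolve measurable_circle : core.

Lemma real_complexX (x : R) n : (x ^+ n)%:C = x%:C ^+ n.
Proof. by elim: n => // n IH; rewrite !exprS rmorphM /= IH. Qed.

Lemma bernoulli_ge (h : R) n : 0 <= h -> 1 + n%:R * h <= (1 + h) ^+ n.
Proof.
move=> h0; elim: n => [|n IH]; first by rewrite mul0r addr0 expr0.
have -> : (1 + h) ^+ n.+1 = (1 + h) ^+ n + h * (1 + h) ^+ n.
  by rewrite exprS mulrDl mul1r.
have : 1 <= (1 + h) ^+ n by rewrite exprn_ege1// lerDl.
by rewrite -natr1; nra.
Qed.

Lemma bernoulli_le (u : R) n : 0 <= u <= 1 -> 1 - n%:R * u <= (1 - u) ^+ n.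
Proof.
move=> /andP[u0 u1]; elim: n => [|n IH]; first by rewrite mul0r subr0 expr0.
have -> : (1 - u) ^+ n.+1 = (1 - u) ^+ n - u * (1 - u) ^+ n.
  by rewrite exprS mulrBl mul1r.
have : (1 - u) ^+ n <= 1 by rewrite exprn_ile1// ?subr_ge0// gerBl.
by rewrite -natr1; nra.
Qed.

(** With r the square root of q, Bernoulli's inequality for r^(- n) bounds n r^n uniformly in n, and
    one more factor r^n remains to tend to 0. *)
Lemma cvg_mulrn_expr (q : R) : 0 <= q < 1 ->
  (fun n => n%:R * q ^+ n) @ \oo --> (0 : R).
Proof.
move=> /andP[q0 q1].
have [->|qn0] := eqVneq q 0.
  apply: cvg_near_cst; exists 1%N => // n /=; case: n => // n _.
  by rewrite expr0n mulr0.
set r := Num.sqrt q.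
have r0 : 0 < r by rewrite sqrtr_gt0 lt_def qn0.
have r1 : r < 1 by rewrite -sqrtr1 ltr_sqrt.
have qE : q = r * r by rewrite -expr2 sqr_sqrtr.
have s1 : 0 < r^-1 - 1 by rewrite subr_gt0 invf_gt1.
have rn : (fun n => (r^-1 - 1)^-1 * r ^+ n) @ \oo --> (0 : R).
  have := @cvg_seqZ _ (r^-1 - 1)^-1 _ _ (@cvg_expr R r _).
  by rewrite mulr0; apply; rewrite ger0_norm// ltW.
apply: (squeeze_cvgr _ (cvg_cst 0) rn); apply: nearW => n.
rewrite mulr_ge0 ?exprn_ge0//= qE exprMn mulrA ler_pM2r ?exprn_gt0//.
have rn0 : 0 < r ^+ n by rewrite exprn_gt0.
have := bernoulli_ge n (ltW s1); rewrite (addrC 1 (r^-1 - 1)) subrK exprVn.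
rewrite -(ler_pM2r rn0) mulVf ?gt_eqF// => h.
by rewrite -(ler_pM2l s1) mulfV ?gt_eqF//; nra.
Qed.

(* The extra factor n in the exponent gives the limit 0 also at y = 1 / 2; composed
   with cos, these polynomials are trigonometric polynomials tending everywhere to
   the indicator of an open arc. *)
Lemma cvg_step_poly (y : R) : 0 <= y <= 1 ->
  (fun n => (1 - y ^+ n) ^+ (n * 2 ^ n)) @ \oo --> ((y < 2^-1)%R%:R : R).
Proof.
move=> /andP[y0 y1].
have yn n : 0 <= y ^+ n <= 1 by rewrite exprn_ge0// exprn_ile1.
have yn1 n : 0 <= 1 - y ^+ n <= 1.
  by case/andP: (yn n) => ? ?; rewrite subr_ge0 gerBl; apply/andP.
have NE n : (n * 2 ^ n)%:R * y ^+ n = n%:R * (2 * y) ^+ n.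
  by rewrite natrM natrX exprMn mulrA.
case: ltP => yh.
  have y2 : 0 <= 2 * y < 1 by apply/andP; split; lra.
  (* Below 1 / 2, Bernoulli's inequality gives the lower bound 1 - n (2 y)^n, which tends to 1. *)
  apply: (@squeeze_cvgr _ _ _ _ (fun n => 1 - n%:R * (2 * y) ^+ n) (cst 1)).
  - apply: nearW => n; rewrite -NE bernoulli_le//=.
    by case/andP: (yn1 n) => ? ?; rewrite exprn_ile1.
  - rewrite -[X in _ --> X]subr0; apply: cvgB; first exact: cvg_cst.
    exact: cvg_mulrn_expr.
  - exact: cvg_cst.
(* From 1 / 2 on, put u = y^n and let M be the exponent. Then (1 - u)^M (1 + u)^M <= 1, while (1 +
   u)^M >= 1 + M u >= n + 1, so the sequence is at most 1 / (n + 1). *)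
apply: (@squeeze_cvgr _ _ _ _ (cst 0) (@harmonic R)).
- apply: nearW => n; have /andP[a0 a1] := yn1 n; rewrite exprn_ge0//=.
  rewrite -[leRHS]mul1r ler_pdivlMr//.
  have /andP[b0 b1] := yn n.
  have h1 := bernoulli_ge (n * 2 ^ n) b0.
  have h2 : n.+1%:R <= 1 + (n * 2 ^ n)%:R * y ^+ n.
    rewrite NE -natr1 addrC lerD2l ler_peMr// exprn_ege1//; lra.
  apply: (@le_trans _ _ ((1 - y ^+ n) ^+ (n * 2 ^ n) * (1 + y ^+ n) ^+ (n * 2 ^ n))).
    by rewrite ler_wpM2l ?exprn_ge0//; apply: le_trans h2 h1.
  rewrite -exprMn exprn_ile1//; nra.
- exact: cvg_cst.
- exact: cvg_harmonic.
Qed.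

Lemma indic_sqr (A : set R) x : (\1_A x : R) ^+ 2 = \1_A x.
Proof. by rewrite indicE; case: (x \in A); rewrite ?expr1n ?expr0n. Qed.

Definition indC (A : set R) : R -> R[i] := fun x => (\1_A x : R)%:C.

Lemma inL2_indC (A : set R) : mset A -> inL2 (indC A).
Proof.
move=> mA; apply: (@inL2_bounded _ _ 1) => /=.
- exact: measurable_indic.
- exact: measurable_cst.
- move=> x _; rewrite /sqmod /= indic_sqr expr0n addr0 indicE.
  by case: (x \in A).
Qed.

(** The difference of cosines is 2 sin (x / 2) sin ((b - x) / 2), whose first factor is nonnegative
    on the circle, so its sign tells whether x lies on the arc. Division by 4 keeps the left side in
    [0, 1], the range where [cvg_step_poly] applies. *)
Lemma arc_cos (b x : R) : 0 <= b <= 2 * pi -> 0 <= x <= 2 * pi ->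
  (2^-1 - (cos (x - b / 2) - cos (b / 2)) / 4 < 2^-1) = (0 < x < b).
Proof.
move=> /andP[b0 b1] /andP[x0 x1].
have -> : cos (x - b / 2) - cos (b / 2) = 2 * (sin (x / 2) * sin ((b - x) / 2)).
  have -> : x - b / 2 = x / 2 - (b - x) / 2 by field.
  rewrite [X in _ - cos X](_ : b / 2 = x / 2 + (b - x) / 2); last by field.
  by rewrite cosB cosD; ring.
have sx : 0 <= sin (x / 2) by apply: sin_ge0_pi; apply/andP; split; lra.
apply/idP/idP => [h|/andP[x0' xb]]; last first.
  have s1 : 0 < sin (x / 2) by apply: sin_gt0_pi; apply/andP; split; lra.
  have s2 : 0 < sin ((b - x) / 2) by apply: sin_gt0_pi; apply/andP; split; lra.
  have := mulr_gt0 s1 s2; lra.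
have {}h : 0 < sin (x / 2) * sin ((b - x) / 2) by lra.
apply/andP; split.
  rewrite lt_def x0 andbT; apply/eqP => x00.
  by move: h; rewrite x00 mul0r sin0 mul0r ltxx.
rewrite ltNge; apply/negP => bx.
have : 0 <= sin ((x - b) / 2) by apply: sin_ge0_pi; apply/andP; split; lra.
have -> : (x - b) / 2 = - ((b - x) / 2) by field.
by rewrite sinN => ?; nra.
Qed.

Lemma reached_arc (b : R) : 0 <= b <= 2 * pi ->
  reached fourier_basis (indC `]0, b[%classic).
Proof.
move=> b01; pose y x : R := 2^-1 - (cos (x - b / 2) - cos (b / 2)) / 4.
have y01 x : 0 <= y x <= 1.
  rewrite /y; have := cos_le1 (x - b / 2); have := cos_geN1 (x - b / 2).
  have := cos_le1 (b / 2); have := cos_geN1 (b / 2); lra.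
pose F n : R -> R[i] := fun x => ((1 - y x ^+ n) ^+ (n * 2 ^ n))%:C.
have ty : trigpoly (fun x => (y x)%:C).
  have := trigpolyD (trigpoly_cst (2^-1 + cos (b / 2) / 4)%:C)
    (trigpolyZ (- 4^-1)%:C (trigpoly_cosB (b / 2))).
  congr trigpoly; apply/funext => x; rewrite -rmorphM -rmorphD /=; congr _%:C.
  by rewrite /y; field.
have tF n : trigpoly (F n).
  have := trigpolyX (n * 2 ^ n) (trigpolyD (trigpoly_cst 1)
    (trigpolyZ (-1) (trigpolyX n ty))).
  congr trigpoly; apply/funext => x.
  rewrite /F mulN1r.
  by rewrite -real_complexX -(rmorphB (real_complex R) 1) -real_complexX.
have F01 n x : 0 <= (1 - y x ^+ n) ^+ (n * 2 ^ n) <= 1.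
  have /andP[y0 y1] := y01 x.
  have h0 : 0 <= 1 - y x ^+ n by rewrite subr_ge0 exprn_ile1.
  by rewrite exprn_ge0// exprn_ile1// gerBl exprn_ge0.
apply: (@reached_cvg _ _ F) => //.
- exact: orthonormal_fourier_basis.
- by move=> n; exact: reached_trigpoly.
- by apply: inL2_indC; exact: measurable_itv.
apply: (@L2_dominated_cvg _ _ _ (fun=> 1)).
- by move=> n; have [] := reached_trigpoly (tF n).
- by apply: inL2_indC; exact: measurable_itv.
- exact: integrable_circle_cst.
- move=> n x _; rewrite /sqmod !ReImE /= oppr0 addr0 expr0n addr0.
  have /andP[f0 f1] := F01 n x; rewrite indicE.
  by case: (x \in _) => /=; nra.
- move=> x; rewrite /circle /= in_itv /= => x01.
  have := cvg_step_poly (y01 x); rewrite /y arc_cos// indicE.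
  by rewrite (_ : (x \in `]0, b[%classic) = (0 < x < b))// mem_setE.
- by move=> x _ /=; exact: cvg_cst.
Qed.

End Density.

(** * From arcs to measurable sets, simple functions and all square-integrable functions *)

Section Completeness.
Context {R : realType}.
Notation mu := (@lebesgue_measure R).
Notation D := (@circle R).
Notation Re := (@complex.Re R).
Notation Im := (@complex.Im R).
Notation measurable_on := (@measurable_fun _ _ (measurableTypeR R) _ D).
Notation mset := (@measurable _ (measurableTypeR R)).
Implicit Types (u v : R -> R) (f g h : R -> R[i]) (z c : R[i]) (n N : nat).
Hint Resolve measurable_circle : core.

(** The endpoints 0 and 2 pi stand for the same point of the circle, where a periodic function
    cannot take two values. They form a null set and are removed until the last step. *)
Let S : set R := `]0, 2 * pi[%classic.

Let mS : mset S. Proof. exact: measurable_itv. Qed.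

(** The half-lines unbounded below are stable under intersection, generate the measurable sets, and
    meet S in arcs starting at 0. Proper differences come from linearity, increasing unions from
    dominated convergence. *)
Lemma reached_measurable (A : set R) : mset A ->
  reached fourier_basis (indC (A `&` S)).
Proof.
have o := @orthonormal_fourier_basis R.
have pi0 : 0 <= 2 * pi :> R by rewrite mulr_ge0 ?pi_ge0.
pose H := [set A : set R | mset A /\ reached fourier_basis (indC (A `&` S))].
suff : mset `<=` H by move=> h /h[].
clear A.
have -> : (mset : set (set R)) = <<s @RGenInftyO.G R >>.
  exact: RGenInftyO.measurableE.
apply: lambda_system_subset => //.
- move=> _ _ [x ->] [y ->]; exists (Num.min x y).
  by apply/seteqP; split => z /=; rewrite !in_itv/= lt_min => /andP.
- split.
  + by move=> A _.
  + split; first exact: measurableT.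
    by rewrite setTI; apply: reached_arc; rewrite pi0 lexx.
  + move=> A B BA [mA rA] [mB rB]; split; first exact: measurableD.
    have := reachedB o rA rB; congr reached; apply/funext => x.
    rewrite /indC -rmorphB /=; congr _%:C; rewrite !indicE ![_ \in _ `&` S]in_setI in_setD.
    case: (boolP (x \in B)) => [/set_mem/BA/mem_set ->|]; case: (x \in S) => /=;
      by rewrite ?andbF ?andbT ?subrr ?subr0.
  + move=> F ndF HF.
    have mF n : mset (F n) by have [] := HF n.
    have mU : mset (\bigcup_i F i) by exact: bigcupT_measurable.
    split=> //.
    apply: (@reached_cvg _ _ (fun n => indC (F n `&` S))) => //.
    * by move=> n; have [] := HF n.
    * by apply: inL2_indC; exact: measurableI.
    apply: (@L2_dominated_cvg _ _ _ (fun=> 1)).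
    * by move=> n; apply: inL2_indC; exact: measurableI.
    * by apply: inL2_indC; exact: measurableI.
    * exact: integrable_circle_cst.
    * move=> n x _; rewrite /sqmod !ReImE /= oppr0 addr0 expr0n addr0 !indicE.
      by case: (x \in _); case: (x \in _); rewrite /= ?subrr ?subr0 ?sub0r
        ?sqrrN ?expr0n ?expr1n.
    (* At each point the indicators of an increasing sequence of sets are eventually constant. *)
    * move=> x _ /=; apply: cvg_near_cst.
      have [[[i _ Fix] Sx]|nU] := pselect ((\bigcup_i F i `&` S) x).
        exists i => // n /= ni; rewrite !indicE !mem_set//; split=> //.
          by exists i.
        by have /subsetPset := ndF _ _ ni; apply.
      exists 0%N => // n _; rewrite !indicE !memNset// => -[Fx Sx].
      by apply: nU; split=> //; exists n.
    * by move=> x _ /=; exact: cvg_cst.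
- move=> _ [x ->]; split; first exact: measurable_itv.
  (* Clamping x to [0, 2 pi] covers the empty and the full intersection at once. *)
  have -> : `]-oo, x[%classic `&` S = `]0, Num.max 0 (Num.min x (2 * pi))[%classic.
    apply/seteqP; split => y /=; rewrite /S/= !in_itv/= lt_max lt_min.
      by case=> yx /andP[-> y2]; rewrite yx y2 orbT.
    case/andP=> y0; rewrite ltNge (ltW y0)/= => /andP[-> ->].
    by rewrite y0.
  by apply: reached_arc; rewrite le_max lexx/= ge_max pi0 ge_min lexx orbT.
Qed.

Lemma reached_sum (F : nat -> R -> R[i]) n :
  (forall k, reached fourier_basis (F k)) ->
  reached fourier_basis (fun x => \sum_(k < n) F k x).
Proof.
move=> rF; have o := @orthonormal_fourier_basis R; elim: n => [|n IH].
  have := reachedZ 0 o (rF 0%N); congr reached; apply/funext => x.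
  by rewrite big_ord0 mul0r.
have := reachedD o IH (rF n); congr reached; apply/funext => x.
by rewrite big_ord_recr.
Qed.

Definition restrS u : R -> R[i] := fun x => (u x * \1_S x)%:C.

Import HBSimple HBNNSimple.

Lemma reached_simple (g : {nnsfun (measurableTypeR R) >-> R}) :
  reached fourier_basis (restrS g).
Proof.
have o := @orthonormal_fourier_basis R.
pose s := fset_set (g @` setT).
have -> : restrS g = fun x => \sum_(i < #|` s|)
    (s`_i)%:C * indC ((g @^-1` [set s`_i]) `&` S) x.
  apply/funext => x; rewrite /restrS (fimfunEord g x) mulr_suml rmorph_sum.
  apply: eq_bigr => i _; rewrite /indC -rmorphM; congr _%:C.
  by rewrite -mulrA indicI.
apply: reached_sum (fun k x => (s`_k)%:C * indC ((g @^-1` [set s`_k]) `&` S) x) _ _ => k.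
apply: reachedZ => //; apply: reached_measurable.
exact: measurable_sfunP.
Qed.

Lemma square_integrable_restrS u : square_integrable u -> inL2 (restrS u).
Proof.
move=> [mu_ iu].
have m1 : measurable_on (fun x => u x * \1_S x).
  by apply: measurable_funM => //; exact: measurable_indic.
apply/inL2P; split; split=> /=.
- exact: m1.
- apply: integrable_dominated iu _; first exact: measurable_funX.
  move=> x _; rewrite ger0_norm ?sqr_ge0// exprMn indicE.
  by case: (x \in S); rewrite ?expr1n ?expr0n ?mulr1 ?mulr0 ?sqr_ge0.
- exact: measurable_cst.
- apply: integrable_dominated iu _; first exact: measurable_cst.
  by move=> x _; rewrite expr0n normr0 sqr_ge0.
Qed.

(** Simple functions increase to u and stay between 0 and u, so the squared errors are dominated by
    u^2. *)
Lemma reached_ge0 u : square_integrable u -> (forall x, 0 <= u x) ->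
  reached fourier_basis (restrS u).
Proof.
move=> su u0; have o := @orthonormal_fourier_basis R; have [mu_ iu] := su.
have mEu : @measurable_fun _ _ (measurableTypeR R) _ D (EFin \o u).
  exact/measurable_EFinP.
pose G n := nnsfun_approx measurable_circle mEu n.
have Eu0 x : D x -> (0%R <= (EFin \o u) x)%E by rewrite lee_fin.
have Gc x : D x -> (fun n => G n x) @ \oo --> u x.
  by move=> Dx; have := cvg_nnsfun_approx measurable_circle mEu Eu0 Dx;
    move/fine_cvg.
have Gu n x : D x -> 0 <= G n x <= u x.
  move=> Dx; apply/andP; split; first exact: fun_ge0.
  have nd : nondecreasing_seq (fun n => G n x).
    by move=> a b ab; have /lefP := nd_nnsfun_approx measurable_circle mEu ab; apply.
  have cG : cvgn (fun n => G n x) by apply/cvg_ex; exists (u x); exact: Gc.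
  by have := nondecreasing_cvgn_le nd cG n; rewrite (cvg_lim _ (Gc x Dx)).
have uL := square_integrable_restrS su.
apply: (@reached_cvg _ _ (fun n => restrS (G n))) => //.
  by move=> n; exact: reached_simple.
apply: (@L2_dominated_cvg _ _ _ (fun x => u x ^+ 2)) => //.
- by move=> n; have [] := reached_simple (G n).
- move=> n x Dx; rewrite /sqmod !ReImE /= oppr0 addr0 expr0n addr0.
  have /andP[g0 gu] := Gu n x Dx; rewrite indicE.
  case: (x \in S) => /=; last by rewrite !mulr0 subrr expr0n sqr_ge0.
  by rewrite !mulr1; nra.
- move=> x Dx /=; apply: cvgM; [exact: Gc|exact: cvg_cst].
- by move=> x _ /=; exact: cvg_cst.
Qed.

Lemma reached_real u : square_integrable u -> reached fourier_basis (restrS u).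
Proof.
move=> su; have o := @orthonormal_fourier_basis R; have [mu_ iu] := su.
have sp v : measurable_on v -> (forall x, `|v x| <= `|u x|) ->
    square_integrable v.
  move=> mv vu; split=> //; apply: integrable_dominated iu _.
    exact: measurable_funX.
  by move=> x _; rewrite normrX -(real_normK (num_real (u x))) lerXn2r ?nnegrE.
have mp : measurable_on (fun x => Num.max (u x) 0).
  by apply: measurable_maxr => //; exact: measurable_cst.
have mn : measurable_on (fun x => Num.max (- u x) 0).
  by apply: measurable_maxr; [exact: measurableT_comp|exact: measurable_cst].
have sup : square_integrable (fun x => Num.max (u x) 0).
  apply: sp => // x; case: (lerP (u x) 0) => h; first by rewrite normr0.
  by [].
have sun : square_integrable (fun x => Num.max (- u x) 0).
  apply: sp => // x; case: (lerP (- u x) 0) => h; first by rewrite normr0.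
  by rewrite normrN.
have := reachedB o (reached_ge0 sup _) (reached_ge0 sun _).
have -> : restrS u = (fun x => restrS (fun x => Num.max (u x) 0) x -
     restrS (fun x => Num.max (- u x) 0) x).
  apply/funext => x; rewrite /restrS -rmorphB /=; congr _%:C.
  rewrite -mulrBl; congr (_ * _).
  case: (lerP (u x) 0) => h; case: (lerP (- u x) 0) => h'; lra.
by apply => x; rewrite le_max lexx orbT.
Qed.

Lemma reached_inL2 f : inL2 f -> reached fourier_basis f.
Proof.
move=> fL; have o := @orthonormal_fourier_basis R.
have /inL2P[sr si] := fL.
have rg := reachedD o (reached_real sr) (reachedZ (0 +i* 1) o (reached_real si)).
(* The function and its restriction to S differ at most at the endpoints, so their distance is 0 and
   one approximant serves for every eps. *)
apply: reached_closed => // eps eps0.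
exists (fun x => restrS (fun y => Re (f y)) x +
  (0 +i* 1) * restrS (fun y => Im (f y)) x) => //.
have [gL _] := rg; have dL := inL2_sub fL gL.
suff : L2norm2 (fun x => f x - (restrS (fun y => Re (f y)) x +
  (0 +i* 1) * restrS (fun y => Im (f y)) x)) = 0%E.
  by rewrite L2norm2E// => -[->].
rewrite /L2norm2 /circle integral_itv_bndoo.
  rewrite -[RHS](@integral0 _ _ _ mu S); apply: eq_integral => x /set_mem xS.
  by rewrite /sqmod !ReImE /= indicE mem_set//=; congr EFin; ring.
have [mr mi _] := dL.
apply: (@measurable_funS _ _ (measurableTypeR R) _ D) => //.
  exact: subset_itv_oo_cc.
by apply/measurable_EFinP; apply: measurable_funD; exact: measurable_funX.
Qed.

Lemma fourier_basis_complete : orthonormal_basis (@fourier_basis R).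
Proof.
have o := @orthonormal_fourier_basis R; have [eL eo] := o.
split=> // f fL; have [_ h] := reached_inL2 fL.
rewrite /L2cvg.
have -> : (fun n => L2norm2 (fun x =>
    \sum_(k < n) L2dot f (fourier_basis k) * fourier_basis k x - f x)) =
  (fun n => (L2sq (fun x => f x - orth_proj fourier_basis f n x))%:E).
  apply/funext => n; rewrite L2norm2E; last first.
    by apply: inL2_sub => //; exact: proj_inL2.
  congr EFin; rewrite -[RHS]mul1r -(_ : sqmod (-1) = 1); last first.
    by rewrite /sqmod cReN cImN /= oppr0 expr0n sqrrN expr1n addr0.
  rewrite -L2sqZ; last by apply: inL2_sub => //; exact: proj_inL2.
  by congr L2sq; apply/funext => x; rewrite /orth_proj; ring.
by apply/fine_cvgP; split; [exact: nearW|exact: h].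
Qed.

End Completeness.

(** * Multiplier operators and their traces *)

Section Trace.
Context {R : realType}.
Notation mu := (@lebesgue_measure R).
Notation D := (@circle R).
Notation Re := (@complex.Re R).
Notation Im := (@complex.Im R).
Notation measurable_on := (@measurable_fun _ _ (measurableTypeR R) _ D).
Implicit Types (u v w : nat -> R) (f g h : R -> R[i]) (z c : R[i]) (n N : nat).
Hint Resolve measurable_circle : core.

(** The bounds are uniform in the number of terms. They serve both for the pointwise sums defining
    the semigroup and for the remainder sums in t. *)
Lemma series_dominated u w (C : R) : (forall k, 0 <= w k) -> 0 <= C ->
  cvgn (series w) -> (forall k, `|u k| <= C * w k) ->
  [/\ cvgn (series u), forall n, `|series u n| <= C * limn (series w) &
      `|limn (series u)| <= C * limn (series w)].
Proof.
move=> w0 C0 cw uw.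
have nd : nondecreasing_seq (series w).
  by apply/nondecreasing_seqP => n; rewrite seriesSr lerDl.
have bnd n : `|series u n| <= C * limn (series w).
  apply: (@le_trans _ _ (C * series w n)); last first.
    by rewrite ler_wpM2l//; exact: nondecreasing_cvgn_le.
  rewrite /series /= (le_trans (ler_norm_sum _ _ _))// mulr_sumr.
  by apply: ler_sum => k _.
have cu : cvgn (series u).
  have s1 k : 0 <= C * w k by rewrite mulr_ge0.
  have s2 : cvgn (series (fun k => C * w k)) by exact: is_cvg_seriesZ.
  by apply: normed_cvg; exact: (series_le_cvg (fun=> normr_ge0 _) s1 uw s2).
split=> //; rewrite ler_norml; apply/andP; split.
  apply: limr_ge => //; apply: nearW => n.
  by have := bnd n; rewrite ler_norml => /andP[].
apply: limr_le => //; apply: nearW => n.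
by have := bnd n; rewrite ler_norml => /andP[].
Qed.

Lemma nneseries_EFin u (l : R) : series u @ \oo --> l ->
  (\sum_(0 <= k <oo) (u k)%:E)%E = l%:E.
Proof.
move=> ul; apply: cvg_lim => //.
have -> : (fun n => \sum_(0 <= k < n) (u k)%:E)%E = EFin \o series u.
  by apply/funext => n /=; rewrite sumEFin.
by apply/fine_cvgP; split; [exact: nearW|exact: ul].
Qed.

Lemma cvg_series_nneseries u (l : R) : (forall k, 0 <= u k) ->
  (\sum_(0 <= k <oo) (u k)%:E)%E = l%:E -> series u @ \oo --> l.
Proof.
move=> u0 ul.
have := @is_cvg_nneseries R (fun k => (u k)%:E) xpredT 0%N
  (fun k _ _ => ltac:(by rewrite lee_fin)).
rewrite ul.
have -> : (fun n => \sum_(0 <= k < n) (u k)%:E)%E = EFin \o series u.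
  by apply/funext => n /=; rewrite sumEFin.
by move/fine_cvg.
Qed.

Section Operator.
Variables (phi : nat -> R -> R[i]) (w : nat -> R) (B : R).
Hypothesis bphi : orthonormal_basis phi.
Hypothesis phiB : forall k x, sqmod (phi k x) <= B.
Hypothesis w0 : forall k, 0 <= w k.
Hypothesis cw : cvgn (series w).

Let ophi : orthonormal_seq phi. Proof. by case: bphi. Qed.

Let B0 : 0 <= B. Proof. exact: le_trans (sqmod_ge0 _) (phiB 0 0). Qed.

Definition multiplier_psum f n : R -> R[i] :=
  fun x => \sum_(k < n) (w k)%:C * L2dot f (phi k) * phi k x.

(** The limit is taken pointwise to obtain an actual function; it exists because the phi k have a
    common bound and w is summable. *)
Definition multiplier f : R -> R[i] := fun x =>
  limn (fun n => Re (multiplier_psum f n x)) +i*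
  limn (fun n => Im (multiplier_psum f n x)).

Let psum_inL2 f n : inL2 (multiplier_psum f n).
Proof.
apply: (@inL2_sum _ (fun k x => (w k)%:C * L2dot f (phi k) * phi k x)) => k.
by apply: inL2_scale; have [] := ophi.
Qed.

Lemma L2dot_sqmod_le f k : inL2 f -> sqmod (L2dot f (phi k)) <= L2sq f.
Proof.
move=> fL; have [eL _] := ophi.
by have := cauchy_schwarz fL (eL k); rewrite L2sq_orthonormal_seq// mulr1.
Qed.

(** From |r| <= 1 + r^2, a bound on squared moduli yields one on real and imaginary parts without
    square roots. *)
Let K f := 1 + L2sq f * B.

Let K0 f : 0 <= K f.
Proof. by rewrite addr_ge0// mulr_ge0// L2sq_ge0. Qed.

Let term_le f k x : inL2 f ->
  `|Re (L2dot f (phi k) * phi k x)| <= K f /\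
  `|Im (L2dot f (phi k) * phi k x)| <= K f.
Proof.
move=> fL; have : sqmod (L2dot f (phi k) * phi k x) <= L2sq f * B.
  by rewrite sqmodM ler_pM ?sqmod_ge0//; exact: L2dot_sqmod_le.
rewrite /K /sqmod; set r := Re _; set i := Im _ => h.
have := sqr_ge0 (r - 1); have := sqr_ge0 (r + 1).
have := sqr_ge0 (i - 1); have := sqr_ge0 (i + 1).
have := sqr_ge0 r; have := sqr_ge0 i.
by move=> *; split; rewrite ler_norml; apply/andP; split; nra.
Qed.

Let psumE f x :
  ((fun n => Re (multiplier_psum f n x)) =
   series (fun k => w k * Re (L2dot f (phi k) * phi k x))) *
  ((fun n => Im (multiplier_psum f n x)) =
   series (fun k => w k * Im (L2dot f (phi k) * phi k x))).
Proof.
split; apply/funext; elim=> [|n IH].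
- by rewrite /multiplier_psum big_ord0 /series /= big_geq.
- rewrite /multiplier_psum big_ord_recr /= cReD IH seriesSr; congr (_ + _).
  by rewrite -mulrA cReM /= mul0r subr0.
- by rewrite /multiplier_psum big_ord0 /series /= big_geq.
- rewrite /multiplier_psum big_ord_recr /= cImD IH seriesSr; congr (_ + _).
  by rewrite -mulrA cImM /= mul0r addr0.
Qed.

Let dom f x : inL2 f ->
  [/\ cvgn (fun n => Re (multiplier_psum f n x)),
      forall n, `|Re (multiplier_psum f n x)| <= K f * limn (series w) &
      `|Re (multiplier f x)| <= K f * limn (series w)] /\
  [/\ cvgn (fun n => Im (multiplier_psum f n x)),
      forall n, `|Im (multiplier_psum f n x)| <= K f * limn (series w) &
      `|Im (multiplier f x)| <= K f * limn (series w)].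
Proof.
move=> fL; split.
  have := @series_dominated (fun k => w k * Re (L2dot f (phi k) * phi k x)) w
    (K f) w0 (K0 f) cw; rewrite /multiplier /= -psumE => h.
  have [|c1 c2 c3] := h.
    move=> k; rewrite normrM ger0_norm// mulrC ler_wpM2r//.
    by have [] := term_le k x fL.
  by split=> // n; have := c2 n; rewrite -psumE.
have := @series_dominated (fun k => w k * Im (L2dot f (phi k) * phi k x)) w
  (K f) w0 (K0 f) cw; rewrite /multiplier /= -psumE => h.
have [|c1 c2 c3] := h.
  move=> k; rewrite normrM ger0_norm// mulrC ler_wpM2r//.
  by have [] := term_le k x fL.
by split=> // n; have := c2 n; rewrite -psumE.
Qed.

Lemma multiplier_inL2 f : inL2 f -> inL2 (multiplier f).
Proof.
move=> fL.
apply: (@inL2_bounded _ _ (2 * (K f * limn (series w)) ^+ 2)).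
- apply: (@measurable_fun_cvg _ _ R D
    (fun n x => Re (multiplier_psum f n x))).
    by move=> n; have [] := psum_inL2 f n.
  by move=> x _; have [[]] := dom x fL.
- apply: (@measurable_fun_cvg _ _ R D
    (fun n x => Im (multiplier_psum f n x))).
    by move=> n; have [] := psum_inL2 f n.
  by move=> x _; have [_ []] := dom x fL.
- move=> x _; have [[_ _ a] [_ _ b]] := dom x fL; rewrite /sqmod.
  move: a b; rewrite !ler_norml => /andP[a1 a2] /andP[b1 b2]; nra.
Qed.

Lemma multiplier_L2cvg f : inL2 f ->
  (fun n => L2sq (fun x => multiplier_psum f n x - multiplier f x)) @ \oo
    --> (0 : R).
Proof.
move=> fL.
(* Both components of the partial sums and of the limit are bounded by M, so each difference is at
   most 2 M, and the two squares add up to at most 8 M^2. *)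
apply: (@L2_dominated_cvg _ _ _ (fun=> 8 * (K f * limn (series w)) ^+ 2)).
- by move=> n; exact: psum_inL2.
- exact: multiplier_inL2.
- exact: integrable_circle_cst.
- move=> n x _; have [[_ a' a] [_ b' b]] := dom x fL.
  move: a b (a' n) (b' n); rewrite /sqmod !ReImE !ler_norml.
  set M := K f * _; move=> /andP[a1 a2] /andP[b1 b2] /andP[c1 c2] /andP[d1 d2].
  have p (s r : R) : - M <= s -> s <= M -> - M <= r -> r <= M ->
    (s - r) ^+ 2 <= 4 * M ^+ 2 by move=> *; nra.
  have -> : 8 * M ^+ 2 = 4 * M ^+ 2 + 4 * M ^+ 2 by ring.
  by apply: lerD; exact: p.
- by move=> x _; have [[]] := dom x fL.
- by move=> x _; have [_ []] := dom x fL.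
Qed.

Lemma L2dot_multiplier_psum f n : inL2 f ->
  L2dot (multiplier_psum f n) f =
  (\sum_(k < n) w k * sqmod (L2dot f (phi k)))%:C.
Proof.
move=> fL; have [eL _] := ophi.
rewrite (@L2dot_suml _ (fun k x => (w k)%:C * L2dot f (phi k) * phi k x))//.
  rewrite rmorph_sum; apply: eq_bigr => k _.
  rewrite L2dotZl// (L2dotC fL (eL k)).
  by apply: complex_ext; rewrite /sqmod !ReImE /=; ring.
by move=> k; exact: inL2_scale.
Qed.

(** Cauchy-Schwarz turns L2 convergence of the partial sums into convergence of their pairings with
    f. These pairings are real, so the limit is real too. *)
Lemma cvg_L2dot_multiplier f : inL2 f ->
  (fun n => \sum_(k < n) w k * sqmod (L2dot f (phi k))) @ \oo -->
    Re (L2dot (multiplier f) f) /\ Im (L2dot (multiplier f) f) = 0.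
Proof.
move=> fL; have TL := multiplier_inL2 fL.
set b := fun n => \sum_(k < n) w k * sqmod (L2dot f (phi k)).
set z := L2dot (multiplier f) f.
have zc n : (b n - Re z) ^+ 2 + Im z ^+ 2 <=
    L2sq (fun x => multiplier_psum f n x - multiplier f x) * L2sq f.
  have := cauchy_schwarz (inL2_sub (psum_inL2 f n) TL) fL.
  by rewrite L2dotBl// L2dot_multiplier_psum// /sqmod !ReImE /= sub0r sqrrN.
have c0 : (fun n => (b n - Re z) ^+ 2 + Im z ^+ 2) @ \oo --> (0 : R).
  have h := @cvg_seqZ _ (L2sq f) _ _ (multiplier_L2cvg fL).
  rewrite mulr0 in h.
  apply: (squeeze_cvgr _ (cvg_cst 0) h); apply: nearW => n.
  by rewrite addr_ge0 ?sqr_ge0//= [leRHS]mulrC.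
split; last first.
  apply/eqP; rewrite -sqrf_eq0 eq_le sqr_ge0 andbT.
  rewrite -(cvg_lim (@norm_hausdorff _ _) c0).
  apply: limr_ge; first by apply/cvg_ex; exists 0.
  by apply: nearW => n; rewrite lerDr sqr_ge0.
have c1 : (fun n => (b n - Re z) ^+ 2) @ \oo --> (0 : R).
  apply: (squeeze_cvgr _ (cvg_cst 0) c0); apply: nearW => n.
  by rewrite sqr_ge0 lerDl sqr_ge0.
apply/cvgrPdist_lt => eps eps0.
move/cvgrPdist_lt : c1 => /(_ _ (exprn_gt0 2 eps0))[N _ hN].
exists N => // n /hN /=; rewrite sub0r normrN ger0_norm ?sqr_ge0// => h.
by rewrite distrC -(ltr_pXn2r (n := 2)) ?nnegrE ?(ltW eps0)// real_normK ?num_real.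
Qed.

(** The diagonal entries in e form a double series of nonnegative terms. After the interchange, the
    sum over the vectors of e is the squared norm of phi m, which is 1 by Parseval. *)
Lemma multiplier_trace : has_trace multiplier (limn (series w)).
Proof.
move=> e be; have [eL eo ec] := be; have [pL po _] := bphi.
have Im0 n : Im (\sum_(k < n) L2dot (multiplier (e k)) (e k)) = 0.
  elim: n => [|n IH]; first by rewrite big_ord0.
  rewrite big_ord_recr /= cImD IH add0r.
  by have [] := cvg_L2dot_multiplier (eL n).
split; last by under eq_fun do rewrite Im0; exact: cvg_cst.
pose d k := Re (L2dot (multiplier (e k)) (e k)).
have -> : (fun n => Re (\sum_(k < n) L2dot (multiplier (e k)) (e k))) = series d.
  apply/funext; elim=> [|n IH]; first by rewrite big_ord0 /series /= big_geq.
  by rewrite big_ord_recr /= cReD IH seriesSr.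
have dE k : series (fun m => w m * sqmod (L2dot (e k) (phi m))) @ \oo --> d k.
  have [+ _] := cvg_L2dot_multiplier (eL k); apply: cvg_trans.
  by rewrite /series /=; under eq_fun do rewrite big_mkord.
have t0 k m : 0 <= w m * sqmod (L2dot (e k) (phi m)).
  by rewrite mulr_ge0 ?sqmod_ge0.
have d0 k : 0 <= d k.
  have <- := cvg_lim (@norm_hausdorff _ _) (dE k).
  apply: limr_ge; first by apply/cvg_ex; exists (d k).
  by apply: nearW => n; rewrite /series /= sumr_ge0.
apply: cvg_series_nneseries => //.
transitivity (\sum_(0 <= k <oo) \sum_(0 <= m <oo)
    (w m * sqmod (L2dot (e k) (phi m)))%:E)%E.
  by apply: eq_eseriesr => k _; rewrite (nneseries_EFin (dE k)).
rewrite nneseries_interchange; last by move=> k m; rewrite lee_fin.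
rewrite -(nneseries_EFin cw); apply: eq_eseriesr => m _.
apply: nneseries_EFin.
have := @cvg_seqZ _ (w m) _ _ (parseval be (pL m)).
rewrite L2sq_orthonormal_seq// mulr1; apply: cvg_trans.
rewrite /series /=; apply: near_eq_cvg; apply: nearW => n /=.
rewrite big_mkord mulr_sumr; apply: eq_bigr => k _.
by rewrite (L2dotC (eL k) (pL m)) /sqmod !ReImE sqrrN.
Qed.

End Operator.
End Trace.

(** * Separated solutions in the annulus *)

Section PlaneCalculus.
Context {R : realType}.
Implicit Types (p v : R * R) (f g : R * R -> R) (s c : R) (n : nat).

Lemma line_quotient f p v : (fun h : R => h^-1 *: ((f \o shift p) (h *: v) - f p)) =
  (fun h : R => h^-1 *: (((fun k : R => f (k *: v + p)) \o shift 0) (h *: (1 : R))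
     - f ((0 : R) *: v + p))).
Proof.
apply/funext => h; rewrite /= scale0r add0r addr0; congr (_ *: (f (_ + _) - _)).
by congr (_ *: _); rewrite /GRing.scale /= mulr1.
Qed.

(** A derivative along v at p is an ordinary derivative at 0 along a line, so one-variable rules
    carry over to the plane. *)
Lemma is_derive_line f p v (d : R) :
  is_derive (0 : R) (1 : R) (fun h : R => f (h *: v + p)) d <-> is_derive p v f d.
Proof.
split=> -[df dE]; split.
- by rewrite /derivable line_quotient.
- by rewrite /derive line_quotient.
- by have := df; rewrite /derivable line_quotient.
- by have := dE; rewrite /derive line_quotient.
Qed.

Lemma is_derive_comp_plane (g : R -> R) f p v (df dg : R) :
  is_derive p v f df -> is_derive (f p) 1 g dg ->
  is_derive p v (fun q => g (f q)) (dg * df).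
Proof.
move=> /is_derive_line h hg; apply/is_derive_line.
apply: (is_derive1_comp _ h).
by rewrite scale0r add0r.
Qed.

Lemma is_derive_affine (b c x : R) : is_derive x 1 (fun h : R => h * b + c) b.
Proof.
by apply: is_derive_eq; rewrite ?scaler0 ?add0r ?addr0 /GRing.scale /= mulr1.
Qed.

Lemma is_derive_fst p v : is_derive p v fst v.1.
Proof. by apply/is_derive_line; exact: is_derive_affine. Qed.

Lemma is_derive_snd p v : is_derive p v snd v.2.
Proof. by apply/is_derive_line; exact: is_derive_affine. Qed.

Definition normsq p : R := p.1 ^+ 2 + p.2 ^+ 2.

Definition punctured : set (R * R) := [set p | 0 < normsq p].

Lemma continuous_normsq : continuous (normsq : R * R -> R).
Proof.
move=> p; have -> : normsq = (fun q => q.1 * q.1 + q.2 * q.2) by apply/funext.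
by apply: cvgD; apply: cvgM; (exact: cvg_fst || exact: cvg_snd).
Qed.

Lemma near_punctured p : punctured p -> \forall q \near p, punctured q.
Proof.
move=> p0; apply: (@open_nbhs_nbhs _ p); split=> //.
rewrite (_ : punctured = normsq @^-1` [set x | 0 < x]); last by apply/seteqP; split.
by apply: open_comp; [move=> q _; exact: continuous_normsq|exact: open_gt].
Qed.

(* Functions of the plane built from the coordinates, the real and imaginary
   parts of (x + i y)^n and powers of x^2 + y^2; this class is closed under
   partial derivatives, which are computed symbolically. *)
Inductive pexp :=
| PX | PY | PC of R | PAdd of pexp & pexp | PMul of pexp & pexp
| PRe of nat | PIm of nat | PPow of R | PLn.

Fixpoint peval (e : pexp) p : R :=
  match e with
  | PX => p.1
  | PY => p.2
  | PC c => c
  | PAdd a b => peval a p + peval b p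
  | PMul a b => peval a p * peval b p
  | PRe n => complex.Re ((p.1 +i* p.2) ^+ n)
  | PIm n => complex.Im ((p.1 +i* p.2) ^+ n)
  | PPow s => expR (s * ln (normsq p))
  | PLn => ln (normsq p)
  end.

(** By holomorphy, z^n has derivative n (v1 + i v2) z^(n - 1) along v; for n = 0 the factor n kills
    the term in which the predecessor is truncated. [PPow s] stands for |z|^(2 s). *)
Fixpoint pderive (v : R * R) (e : pexp) : pexp :=
  match e with
  | PX => PC v.1
  | PY => PC v.2
  | PC c => PC 0
  | PAdd a b => PAdd (pderive v a) (pderive v b)
  | PMul a b => PAdd (PMul (pderive v a) b) (PMul a (pderive v b))
  | PRe n => PAdd (PMul (PC (n%:R * v.1)) (PRe n.-1))
                  (PMul (PC (- (n%:R * v.2))) (PIm n.-1))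
  | PIm n => PAdd (PMul (PC (n%:R * v.1)) (PIm n.-1))
                  (PMul (PC (n%:R * v.2)) (PRe n.-1))
  | PPow s => PMul (PMul (PC (2 * s)) (PAdd (PMul (PC v.1) PX) (PMul (PC v.2) PY)))
                   (PPow (s - 1))
  | PLn => PMul (PMul (PC 2) (PAdd (PMul (PC v.1) PX) (PMul (PC v.2) PY)))
                (PPow (- 1))
  end.

Lemma is_derive_normsq p v :
  is_derive p v normsq (2 * (v.1 * p.1 + v.2 * p.2)).
Proof.
have h1 := is_derive_fst p v; have h2 := is_derive_snd p v.
have := is_deriveD (is_deriveM h1 h1) (is_deriveM h2 h2).
have -> : fst * fst + snd * snd = normsq by apply/funext => q.
by move/is_derive_eq; apply; rewrite /GRing.scale /=; ring.
Qed.

Lemma is_derive_ln_normsq p v : punctured p ->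
  is_derive p v (fun q => ln (normsq q))
   ((normsq p)^-1 * (2 * (v.1 * p.1 + v.2 * p.2))).
Proof.
move=> p0; apply: (is_derive_comp_plane (is_derive_normsq p v)).
exact: is_derive1_ln.
Qed.

Lemma expRN_ln (x : R) : 0 < x -> expR (- 1 * ln x) = x^-1.
Proof. by move=> x0; rewrite mulN1r expRN lnK. Qed.

Lemma is_derive_zpow p v n :
  is_derive p v (peval (PRe n)) (peval (pderive v (PRe n)) p) /\
  is_derive p v (peval (PIm n)) (peval (pderive v (PIm n)) p).
Proof.
elim: n => [|n [IHr IHi]] /=.
  split.
    have := @is_derive_cst _ _ _ (1 : R) p v; move/is_derive_eq; apply.
    by rewrite !mul0r oppr0 mul0r addr0.
  have := @is_derive_cst _ _ _ (0 : R) p v; move/is_derive_eq; apply.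
  by rewrite !mul0r addr0.
have h1 := is_derive_fst p v; have h2 := is_derive_snd p v.
have zS q : (q.1 +i* q.2) ^+ n.+1 =
    (q.1 * peval (PRe n) q - q.2 * peval (PIm n) q) +i*
    (q.1 * peval (PIm n) q + q.2 * peval (PRe n) q).
  by rewrite exprS /=; case: (_ ^+ n).
(* The identity n z^n = n z z^(n - 1) holds for n = 0 as well, so the induction step is uniform in
   n. *)
have nz : n%:R * peval (PRe n) p =
    n%:R * (p.1 * peval (PRe n.-1) p - p.2 * peval (PIm n.-1) p) /\
    n%:R * peval (PIm n) p =
    n%:R * (p.1 * peval (PIm n.-1) p + p.2 * peval (PRe n.-1) p).
  case: n {IHr IHi zS} => [|n]; first by rewrite !mul0r.
  by rewrite /= exprS; case: ((p.1 +i* p.2) ^+ n).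
move: nz IHr IHi; rewrite /= -natr1.
set A := peval (PRe n); set B := peval (PIm n) => -[nzr nzi] IHr IHi.
split.
- have := is_deriveB (is_deriveM h1 IHr) (is_deriveM h2 IHi).
  rewrite (_ : fst * _ - snd * _ = (fun q => complex.Re ((q.1 +i* q.2) ^+ n.+1)));
    last by apply/funext => q; rewrite zS.
  move/is_derive_eq; apply; rewrite /GRing.scale /=.
  move: nzr nzi; rewrite /A /B /=.
  set a := complex.Re ((p.1 +i* p.2) ^+ n); set b := complex.Im ((p.1 +i* p.2) ^+ n).
  set a' := complex.Re _; set b' := complex.Im _ => nzr nzi.
  have := congr1 ( *%R v.1) nzr; have := congr1 ( *%R v.2) nzr.
  have := congr1 ( *%R v.1) nzi; have := congr1 ( *%R v.2) nzi; lra.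
- have := is_deriveD (is_deriveM h1 IHi) (is_deriveM h2 IHr).
  rewrite (_ : fst * _ + snd * _ = (fun q => complex.Im ((q.1 +i* q.2) ^+ n.+1)));
    last by apply/funext => q; rewrite zS.
  move/is_derive_eq; apply; rewrite /GRing.scale /=.
  move: nzr nzi; rewrite /A /B /=.
  set a := complex.Re ((p.1 +i* p.2) ^+ n); set b := complex.Im ((p.1 +i* p.2) ^+ n).
  set a' := complex.Re _; set b' := complex.Im _ => nzr nzi.
  have := congr1 ( *%R v.1) nzr; have := congr1 ( *%R v.2) nzr.
  have := congr1 ( *%R v.1) nzi; have := congr1 ( *%R v.2) nzi; lra.
Qed.

Lemma expR_pred_ln (s x : R) : 0 < x ->
  expR ((s - 1) * ln x) = expR (s * ln x) * x^-1.
Proof. by move=> x0; rewrite mulrBl expRD mul1r expRN lnK. Qed.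

Lemma is_derive_peval e p v : punctured p ->
  is_derive p v (peval e) (peval (pderive v e) p).
Proof.
move=> p0; elim: e => [||c|a IHa b IHb|a IHa b IHb|n|n|s|].
- exact: is_derive_fst.
- exact: is_derive_snd.
- exact: is_derive_cst.
- exact: is_deriveD.
- have := is_deriveM IHa IHb.
  by move/is_derive_eq; apply; rewrite /GRing.scale /=; ring.
- by have [] := is_derive_zpow p v n.
- by have [] := is_derive_zpow p v n.
- have h : is_derive (ln (normsq p)) 1 (fun y : R => expR (s * y))
      (expR (s * ln (normsq p)) * s).
    have hs : is_derive (ln (normsq p)) 1 (fun y : R => s * y) s.
      by apply: is_derive_eq; rewrite ?scaler0 ?add0r ?addr0 [LHS]mulr1.
    exact: (is_derive1_comp (is_derive_expR _) hs).
  have := is_derive_comp_plane (is_derive_ln_normsq v p0) h.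
  by move/is_derive_eq; apply; rewrite /= expR_pred_ln//; ring.
- have := is_derive_ln_normsq v p0.
  move/is_derive_eq; apply; rewrite /= -[- 1]sub0r expR_pred_ln// mul0r expR0; ring.
Qed.

Lemma continuous_peval e p : punctured p -> {for p, continuous (peval e)}.
Proof.
move=> p0.
have zc n : {for p, continuous (peval (PRe n))} /\ {for p, continuous (peval (PIm n))}.
  elim: n => [|n [IHr IHi]]; first by split=> /=; exact: cvg_cst.
  split.
    rewrite /prop_for /continuous_at (_ : peval (PRe n.+1) =
        fun q => q.1 * peval (PRe n) q - q.2 * peval (PIm n) q).
      by apply: cvgB; apply: cvgM => //; (exact: cvg_fst || exact: cvg_snd).
    by apply/funext => q; rewrite /= exprS; case: (_ ^+ n).
  rewrite /prop_for /continuous_at (_ : peval (PIm n.+1) =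
      fun q => q.1 * peval (PIm n) q + q.2 * peval (PRe n) q).
    by apply: cvgD; apply: cvgM => //; (exact: cvg_fst || exact: cvg_snd).
  by apply/funext => q; rewrite /= exprS; case: (_ ^+ n).
have lc : {for p, continuous (peval PLn)}.
  by apply: continuous_comp; [exact: continuous_normsq|exact: continuous_ln].
elim: e => [||c|a IHa b IHb|a IHa b IHb|n|n|s|].
- exact: cvg_fst.
- exact: cvg_snd.
- exact: cvg_cst.
- exact: cvgD.
- exact: cvgM.
- by have [] := zc n.
- by have [] := zc n.
- apply: (@continuous_comp _ _ _ (fun q => s * peval PLn q) expR).
    by apply: cvgM => //; exact: cvg_cst.
  exact: continuous_expR.
- exact: lc.
Qed.

(** Agreement off the origin suffices: the punctured plane is open, so derivatives there agree as
    well. *)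
Definition represents f e := forall p, punctured p -> f p = peval e p.

Lemma near_represents f e p : represents f e -> punctured p ->
  \forall q \near p, peval e q = f q.
Proof.
by move=> fe p0; near=> q; rewrite fe//; near: q; exact: near_punctured.
Unshelve. all: by end_near. Qed.

Lemma is_derive_represents f e p v : represents f e -> punctured p ->
  is_derive p v f (peval (pderive v e) p).
Proof.
move=> fe p0; apply: near_eq_is_derive (is_derive_peval e v p0).
exact: near_represents.
Qed.

Lemma derive_represents f e v : represents f e ->
  represents (fun q => 'D_v f q : R) (pderive v e).
Proof. by move=> fe p p0; have [] := is_derive_represents v fe p0. Qed.

Lemma C1_on_represents f e (D : set (R * R)) : D `<=` punctured ->
  represents f e -> C1_on D f.
Proof.
move=> DP fe p Dp v _; have p0 := DP _ Dp.
split; first by have [] := is_derive_represents v fe p0.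
have h := derive_represents v fe.
have := @continuous_peval (pderive v e) p p0; rewrite /prop_for /continuous_at.
rewrite -(h p p0); apply: cvg_trans; apply: near_eq_cvg.
exact: near_represents.
Qed.

Lemma C2_on_represents f e (D : set (R * R)) : D `<=` punctured ->
  represents f e -> C2_on D f.
Proof.
move=> DP fe; split; first exact: C1_on_represents fe.
by move=> v _; apply: C1_on_represents (derive_represents v fe).
Qed.

End PlaneCalculus.

(** * The Hamiltonian on symbolic expressions *)

Section AharonovBohm.
Context {R : realType}.
Notation Re := (@complex.Re R).
Notation Im := (@complex.Im R).
Implicit Types (p v : R * R) (u : R * R -> R[i]) (s c nu sg : R) (n : nat)
  (ab : pexp (R := R) * pexp (R := R)).

Definition crepresents u ab :=
  represents (fun p => Re (u p)) ab.1 /\ represents (fun p => Im (u p)) ab.2.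

(** The real and imaginary parts of - i d_v (a + i b) - A (a + i b), with A represented by [al]. *)
Definition emomentum v (al : pexp) ab : pexp * pexp :=
  (PAdd (pderive v ab.2) (PMul (PC (- 1)) (PMul al ab.1)),
   PMul (PC (- 1)) (PAdd (pderive v ab.1) (PMul al ab.2))).

Lemma crepresents_momentum v (A : R * R -> R) al u ab :
  represents A al -> crepresents u ab ->
  crepresents (momentum v A u) (emomentum v al ab).
Proof.
move=> rA [ra rb]; split => p p0; rewrite /momentum /cderive.
  rewrite (derive_represents v ra p0) (derive_represents v rb p0) rA//.
  by rewrite !cReD !cReN !cReM /= (ra p p0) (rb p p0) /=; ring.
rewrite (derive_represents v ra p0) (derive_represents v rb p0) rA//.
by rewrite !cImD !cImN !cImM /= (ra p p0) (rb p p0) /=; ring.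
Qed.

Definition eAB1 nu : pexp := PMul (PC (- nu)) (PMul (PPow (- 1)) PY).
Definition eAB2 nu : pexp := PMul (PC nu) (PMul (PPow (- 1)) PX).

Lemma sqr_radius p : Defs.radius p ^+ 2 = normsq p.
Proof. by rewrite sqr_sqrtr// addr_ge0 ?sqr_ge0. Qed.

Lemma represents_AB1 nu : represents (AB1 nu) (eAB1 nu).
Proof.
by move=> p p0; rewrite /AB1 sqr_radius /= expRN_ln//; ring.
Qed.

Lemma represents_AB2 nu : represents (AB2 nu) (eAB2 nu).
Proof. by move=> p p0; rewrite /AB2 sqr_radius /= expRN_ln//; ring. Qed.

Definition ehamiltonian nu ab : pexp * pexp :=
  let m1 := emomentum (dir1 R) (eAB1 nu) (emomentum (dir1 R) (eAB1 nu) ab) in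
  let m2 := emomentum (dir2 R) (eAB2 nu) (emomentum (dir2 R) (eAB2 nu) ab) in
  (PAdd m1.1 m2.1, PAdd m1.2 m2.2).

Lemma crepresents_hamiltonian nu u ab : crepresents u ab ->
  crepresents (AB_hamiltonian nu u) (ehamiltonian nu ab).
Proof.
move=> rab.
have [r1 i1] := crepresents_momentum (dir1 R) (represents_AB1 nu)
  (crepresents_momentum (dir1 R) (represents_AB1 nu) rab).
have [r2 i2] := crepresents_momentum (dir2 R) (represents_AB2 nu)
  (crepresents_momentum (dir2 R) (represents_AB2 nu) rab).
split=> p p0; rewrite /AB_hamiltonian.
  by rewrite cReD; exact: congr2 (r1 p p0) (r2 p p0).
by rewrite cImD; exact: congr2 (i1 p p0) (i2 p p0).
Qed.

(** F z^n for sg = 1 and F conj(z)^n for sg = - 1, so that both signs of the Fourier mode share one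
    computation. *)
Definition emode sg n (F : pexp) : pexp * pexp :=
  (PMul F (PRe n), PMul (PC sg) (PMul F (PIm n))).

(** If sg is 1 or - 1 and m = sg n, the first coefficient is (m - nu)^2 - (2 s + n)^2 and the second
    is sg times it: angular energy minus the square of the radial exponent. Both vanish when 2 s + n
    is m - nu or its opposite. *)
Lemma ehamiltonian_pow nu sg n s p : punctured p ->
  peval (ehamiltonian nu (emode sg n (PPow s))).1 p =
    (nu ^+ 2 - 2 * nu * sg * n%:R - 4 * s * (s + n%:R)) *
    (normsq p)^-1 * expR (s * ln (normsq p)) * peval (PRe n) p /\
  peval (ehamiltonian nu (emode sg n (PPow s))).2 p =
    (sg * nu ^+ 2 - 2 * nu * n%:R - 4 * sg * s * (s + n%:R)) *
    (normsq p)^-1 * expR (s * ln (normsq p)) * peval (PIm n) p.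
Proof.
move=> p0; case: p p0 => x y p0.
have w0 : x * x + y * y != 0 by rewrite gt_eqF// -!expr2.
have e1 : expR ((- 1 - 1) * ln (normsq (x, y))) =
    (normsq (x, y))^-1 * (normsq (x, y))^-1.
  by rewrite expR_pred_ln// expRN_ln.
rewrite /ehamiltonian /emomentum /emode /eAB1 /eAB2.
cbn [peval pderive fst snd dir1 dir2].
rewrite e1 !expR_pred_ln// expRN_ln//.
set E := expR (s * _); rewrite /normsq /= !expr2.
(* Two derivatives lower the exponent by up to two, and the truncated predecessors need the
   exponents 0 and 1 apart. *)
case: n => [|[|n]].
- by rewrite expr0 /=; split; field.
- by rewrite expr0 expr1 /=; split; field.
- rewrite !exprS /=; case: ((x +i* y) ^+ n) => A B /=.
  by split; field.
Qed.

End AharonovBohm.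

(** * Solutions with a single Fourier mode and their boundary values *)

Section ModeSolution.
Context {R : realType}.
Notation Re := (@complex.Re R).
Notation Im := (@complex.Im R).
Implicit Types (p v : R * R) (u : R * R -> R[i]) (s c nu rho : R) (n : nat)
  (m : int) (F G : pexp (R := R)) (z : R[i]).

Lemma fourierE (f : R -> R[i]) m :
  fourier f m = ((2 * pi)^-1)%:C * L2dot f (expi m).
Proof. by []. Qed.

Lemma fourier_expi z m m' :
  fourier (fun x => z * expi m x) m' = if m == m' then z else 0.
Proof.
rewrite fourierE L2dotZl ?L2dot_expi; [|exact: expi_inL2..].
case: eqP => _; last by rewrite !mulr0.
rewrite mulrCA -rmorphM /= mulVf ?mulr1//.
by rewrite gt_eqF// mulr_gt0 ?pi_gt0.
Qed.

(** With one nonzero coefficient, the Sobolev limits at the boundary become limits of a scalar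
    function of r. *)
Lemma Hnorm2_single s m z :
  Hnorm2 s (fun m' => if m == m' then z else 0) =
  ((1 + m%:~R ^+ 2) `^ s * sqmod z)%:E.
Proof.
rewrite /Hnorm2 -(@esum_set1 _ _ m (fun m => ((1 + m%:~R ^+ 2) `^ s * sqmod z)%:E)).
  rewrite [RHS]esum_mkcond; apply: eq_esum => m' _.
  case: eqP => [->|mm']; first by rewrite mem_set.
  rewrite memNset; last by move=> /esym.
  by rewrite /sqmod /= expr0n addr0 mulr0.
by rewrite lee_fin mulr_ge0 ?sqmod_ge0// powR_ge0.
Qed.

Lemma polar_zpow (r x : R) n :
  ((Defs.polar r x).1 +i* (Defs.polar r x).2) ^+ n = (r ^+ n)%:C * expi n%:Z x.
Proof.
elim: n => [|n IH]; first by rewrite !expr0 /expi mul0r cos0 sin0 mulr1.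
rewrite exprS IH -[n.+1%:Z]/(1 + n)%:Z PoszD -expiM.
by apply: complex_ext; rewrite ?(cReM, cImM) /= exprS mul1r; ring.
Qed.

Lemma normsq_polar (r x : R) : normsq (Defs.polar r x) = r ^+ 2.
Proof. by rewrite /normsq /= !exprMn -mulrDr cos2Dsin2 mulr1. Qed.

Definition mode_sign m : R := if 0 <= m then 1 else -1.

Lemma mode_sign_abs m : mode_sign m * `|m|%N%:R = m%:~R.
Proof.
rewrite /mode_sign; case: ifPn => m0.
  by rewrite mul1r -{2}(gez0_abs m0).
by rewrite mulN1r -[in RHS](opprK m) rmorphN /= -ltz0_abs// ltNge.
Qed.

Lemma expi_abs m x :
  (Re (expi `|m|%N x) = Re (expi m x)) *
  (mode_sign m * Im (expi `|m|%N x) = Im (expi m x)).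
Proof.
rewrite /expi /= -(mode_sign_abs m) /mode_sign -[ `|m|%N%:~R]/(`|m|%N%:R).
case: ifP => _; first by rewrite !mul1r.
by rewrite !mulN1r !mulNr cosN sinN.
Qed.

(* F times z^m if m >= 0, and F times conj(z)^(-m) otherwise. *)
Definition msol m F : R * R -> R[i] :=
  fun p => peval (emode (mode_sign m) `|m|%N F).1 p +i*
           peval (emode (mode_sign m) `|m|%N F).2 p.

Lemma on_circle_msol m F (g : R -> R) r x :
  (peval F (Defs.polar r x) * r ^+ `|m|%N = g r) ->
  on_circle (msol m F) r x = (g r)%:C * expi m x.
Proof.
move=> gE; rewrite /on_circle /msol.
have [hr hi] := expi_abs m x.
apply: complex_ext; rewrite ?cReM ?cImM.
  rewrite [LHS]/= polar_zpow cReM -hr -gE.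
  by move: (expi _ x) => A; rewrite /=; ring.
rewrite [LHS]/= polar_zpow cImM -hi -gE.
by move: (expi _ x) => A; rewrite /=; ring.
Qed.

Lemma near_gt0 (r : R) : 0 < r -> \forall h \near (0 : R), 0 < h + r.
Proof.
move=> r0; exists r => //= h.
by rewrite /ball_ /= sub0r normrN ltr_norml => /andP[h1 _]; lra.
Qed.

Lemma radial_derive_msol m F (g g' : R -> R) r x :
  (forall r x, 0 < r -> peval F (Defs.polar r x) * r ^+ `|m|%N = g r) ->
  (forall r : R, 0 < r -> is_derive r (1 : R) g (g' r)) -> 0 < r ->
  radial_derive (msol m F) r x = (g' r)%:C * expi m x.
Proof.
move=> gE dg r0; rewrite /radial_derive /cderive.
(* Moving along the radial direction changes only r, so the radial derivative of the solution is
   that of its profile g. *)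
have pol h : h *: (cos x, sin x) + Defs.polar r x = Defs.polar (h + r) x.
  by rewrite /Defs.polar !mulrDl.
have key (f : R -> R) (k : R) : is_derive (0 : R) (1 : R) (fun h => g (h + r) * k) (g' r * k).
  have h1 : is_derive (0 : R) 1 (fun h : R => h + r) 1.
    by apply: is_derive_eq; rewrite addr0.
  have h2 : is_derive ((0 : R) + r) 1 g (g' r) by rewrite add0r; exact: dg.
  have h3 := @is_derive1_comp _ g (fun h : R => h + r) 0 _ _ h2 h1.
  have := is_deriveM h3 (@is_derive_cst _ _ _ k (0 : R) (1 : R)).
  by move/is_derive_eq; apply; rewrite /GRing.scale /= mulr0 mulr1 add0r mulrC.
apply: complex_ext; rewrite /= !mul0r ?subr0 ?addr0.
  have /is_derive_line[_ ->//] : is_derive (0 : R) (1 : R)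
    (fun h => Re (msol m F (h *: (cos x, sin x) + Defs.polar r x)))
    (g' r * Re (expi m x)).
  apply: near_eq_is_derive (key g _).
  have := near_gt0 r0; apply: filterS => h hr.
  rewrite pol; have := on_circle_msol (gE _ x hr); rewrite /on_circle => ->.
  by rewrite cReM /= mul0r subr0.
have /is_derive_line[_ ->//] : is_derive (0 : R) (1 : R)
  (fun h => Im (msol m F (h *: (cos x, sin x) + Defs.polar r x)))
  (g' r * Im (expi m x)).
apply: near_eq_is_derive (key g _).
have := near_gt0 r0; apply: filterS => h hr.
rewrite pol; have := on_circle_msol (gE _ x hr); rewrite /on_circle => ->.
by rewrite cImM /= mul0r addr0.
Qed.

Lemma annulus_punctured rho : 0 < rho -> annulus rho `<=` punctured.
Proof.
move=> rho0 p /andP[rp _]; rewrite /punctured /= -sqr_radius exprn_gt0//.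
exact: lt_trans rp.
Qed.

Lemma crepresents_msol m F :
  crepresents (msol m F) (emode (mode_sign m) `|m|%N F).
Proof. by split. Qed.

Lemma cvg_Hnorm2_single (Fl : set_system R) (FF : ProperFilter Fl) s m
    (g : R -> R) (c : R) (H : R -> \bar R) :
  g @ Fl --> c ->
  (\forall r \near Fl, H r = Hnorm2 s
     (fun m' => if m == m' then (g r - c)%:C else 0)) ->
  H @ Fl --> 0%E.
Proof.
move=> gc HE.
have : (fun r => ((1 + m%:~R ^+ 2) `^ s * (g r - c) ^+ 2)%:E) @ Fl --> 0%E.
  apply/fine_cvgP; split; first exact: nearW.
  rewrite /comp /=.
  have -> : (0 : R) = (1 + m%:~R ^+ 2) `^ s * ((c - c) * (c - c)).
    by rewrite subrr !mulr0.
  apply: cvgM; first exact: cvg_cst.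
  by under eq_fun do rewrite expr2; apply: cvgM; apply: cvgB => //; exact: cvg_cst.
apply: cvg_trans; apply: near_eq_cvg; near=> r.
rewrite (near HE r)// Hnorm2_single /sqmod /=.
by rewrite ?oppr0 expr0n addr0.
Unshelve. all: by end_near. Qed.

(** Everything is read off the radial profile g: the boundary conditions are its values at 1 and
    rho, and the eigenvalue is the ratio of g' to g at 1. The limits in the Sobolev norms reduce to
    continuity of g and g'. *)
Lemma DN_msol nu rho m F (g g' : R -> R) (c lam : R) :
  0 < rho -> rho < 1 ->
  (forall r x, 0 < r -> peval F (Defs.polar r x) * r ^+ `|m|%N = g r) ->
  (forall r : R, 0 < r -> is_derive r (1 : R) g (g' r)) ->
  (forall p, punctured p ->
     peval (ehamiltonian nu (emode (mode_sign m) `|m|%N F)).1 p = 0 /\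
     peval (ehamiltonian nu (emode (mode_sign m) `|m|%N F)).2 p = 0) ->
  g 1 = c -> g rho = 0 -> g' 1 = lam * c -> {for 1, continuous g'} ->
  DN nu rho (fun x => c%:C * expi m x) (fun x => lam%:C * (c%:C * expi m x)).
Proof.
move=> rho0 rho1 gE dg ham g1 grho g'1 cg'.
have cg r : 0 < r -> {for r, continuous g}.
  move=> r0; apply: differentiable_continuous; apply/derivable1_diffP.
  by case: (dg r r0).
split; first by do 2 apply: inL2_scale; exact: expi_inL2.
split.
  split; first by apply: inL2_scale; exact: expi_inL2.
  have -> : fourier (fun x => c%:C * expi m x) =
      (fun m' => if m == m' then c%:C else 0).
    by apply/funext => m'; exact: fourier_expi.
  by rewrite Hnorm2_single ltry.
have fE r m' : 0 < r -> fourier (on_circle (msol m F) r) m' =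
    if m == m' then (g r)%:C else 0.
  move=> r0; rewrite -(fourier_expi (g r)%:C m m').
  suff -> : on_circle (msol m F) r = (fun x => (g r)%:C * expi m x) by [].
  by apply/funext => x; exact: on_circle_msol (gE r x r0).
have fdE r m' : 0 < r -> fourier (radial_derive (msol m F) r) m' =
    if m == m' then (g' r)%:C else 0.
  move=> r0; rewrite -(fourier_expi (g' r)%:C m m').
  suff -> : radial_derive (msol m F) r = (fun x => (g' r)%:C * expi m x) by [].
  by apply/funext => x; exact: radial_derive_msol gE dg r0.
have near1 : \forall r \near (1 : R)^'-, 0 < r.
  by apply: nbhs_left_gt.
have nearrho : \forall r \near rho^'+, 0 < r.
  near=> r; apply: (lt_trans rho0); near: r; exact: nbhs_right_gt.
exists (msol m F); split; first split.
- have [r1 r2] := crepresents_msol m F.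
  by split; [exact: C2_on_represents (annulus_punctured rho0) r1|
             exact: C2_on_represents (annulus_punctured rho0) r2].
- move=> p /(annulus_punctured rho0) p0.
  have [h1 h2] := crepresents_hamiltonian nu (crepresents_msol m F).
  have [e1 e2] := ham p p0.
  by apply: complex_ext; [rewrite [LHS](h1 p p0)|rewrite [LHS](h2 p p0)].
- apply: (@cvg_Hnorm2_single _ _ _ m g c).
    by rewrite -g1; exact/cvg_at_left_filter/cg.
  near=> r; congr (Hnorm2 _ _); apply/funext => m'.
  rewrite fE; last by near: r.
  rewrite fourier_expi; case: eqP => _; last by rewrite subr0.
  by rewrite -rmorphB.
- apply: (@cvg_Hnorm2_single _ _ _ m g 0).
    by rewrite -grho; exact/cvg_at_right_filter/cg.
  near=> r; congr (Hnorm2 _ _); apply/funext => m'.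
  rewrite fE; last by near: r.
  by rewrite subr0.
- apply: (@cvg_Hnorm2_single _ _ _ m g' (lam * c)).
    by rewrite -g'1; exact/cvg_at_left_filter.
  near=> r; congr (Hnorm2 _ _); apply/funext => m'.
  rewrite fdE; last by near: r.
  under [X in fourier X]eq_fun do rewrite mulrA -rmorphM.
  rewrite fourier_expi; case: eqP => _; last by rewrite subr0.
  by rewrite -rmorphB.
Unshelve. all: by end_near. Qed.

End ModeSolution.

(** * Radial profiles and the eigenvalues of the Dirichlet-to-Neumann operator *)

Section Eigenvalues.
Context {R : realType}.
Implicit Types (p v : R * R) (s c nu rho a d al be : R) (n : nat) (m : int)
  (F G : pexp (R := R)).

Lemma ehamiltonian_lin nu sg n al be F G p :
  let H F := ehamiltonian nu (emode sg n F) in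
  (peval (H (PAdd (PMul (PC al) F) (PMul (PC be) G))).1 p =
    al * peval (H F).1 p + be * peval (H G).1 p) /\
  (peval (H (PAdd (PMul (PC al) F) (PMul (PC be) G))).2 p =
    al * peval (H F).2 p + be * peval (H G).2 p).
Proof.
rewrite /ehamiltonian /emomentum /emode /eAB1 /eAB2.
by cbn [peval pderive fst snd dir1 dir2]; split; ring.
Qed.

Lemma ehamiltonian_ln sg p : punctured p ->
  peval (ehamiltonian 0 (emode sg 0 PLn)).1 p = 0 /\
  peval (ehamiltonian 0 (emode sg 0 PLn)).2 p = 0.
Proof.
move=> p0; case: p p0 => x y p0.
have w0 : x * x + y * y != 0 by rewrite gt_eqF// -!expr2.
have e1 : expR ((- 1 - 1) * ln (normsq (x, y))) =
    (normsq (x, y))^-1 * (normsq (x, y))^-1.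
  by rewrite expR_pred_ln// expRN_ln.
rewrite /ehamiltonian /emomentum /emode /eAB1 /eAB2.
cbn [peval pderive fst snd dir1 dir2].
rewrite e1 expRN_ln// expr0 /normsq /= !expr2.
by split; field.
Qed.

Lemma exprn_expR_ln (r : R) n : 0 < r -> r ^+ n = expR (n%:R * ln r).
Proof. by move=> r0; rewrite mulr_natl -lnXn// lnK// posrE exprn_gt0. Qed.

Lemma is_derive_expR_ln d (r : R) : 0 < r ->
  is_derive r (1 : R) (fun r => expR (d * ln r)) (d * expR (d * ln r) / r).
Proof.
move=> r0.
have h : is_derive r (1 : R) (fun r => d * ln r) (d * r^-1).
  have h := is_derive1_ln r0.
  by apply: is_derive_eq; rewrite ?scaler0 ?add0r ?addr0.
have := is_derive1_comp (is_derive_expR _) h.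
by move/is_derive_eq; apply; ring.
Qed.

Lemma continuous_expR_ln d (r : R) : 0 < r ->
  {for r, continuous (fun r : R => expR (d * ln r))}.
Proof.
move=> r0; apply: differentiable_continuous; apply/derivable1_diffP.
by case: (is_derive_expR_ln d r0).
Qed.

Lemma sinh_neq0 (x : R) : x != 0 -> sinh x != 0.
Proof.
move=> x0; rewrite /sinh mulf_neq0 ?invr_eq0 ?pnatr_eq0// subr_eq0.
by rewrite (inj_eq (@expR_inj R)) -subr_eq0 opprK -mulr2n mulrn_eq0.
Qed.

(** Since coth is odd, the product is even in d. *)
Lemma mulr_coth_norm d a : `|d| * coth (a * `|d|) = d * coth (a * d).
Proof.
have [d0|d0] := lerP 0 d; first by rewrite ger0_norm.
rewrite ltr0_norm// /coth /cosh /sinh mulrN opprK.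
by rewrite [X in _ / (X / 2)](_ : _ = - (expR (a * d) - expR (- (a * d))));
  [rewrite [X in X / 2 / (- _ / 2)]addrC mulNr invrN; ring|ring].
Qed.

Definition dn_eigenvalue a nu m : R := `|m%:~R - nu| + coth_defect a nu m.

Lemma dn_eigenvalueE a nu m : dn_eigenvalue a nu m =
  if m%:~R == nu then a^-1 else (m%:~R - nu) * coth (a * (m%:~R - nu)).
Proof.
rewrite /dn_eigenvalue /coth_defect; case: eqP => [->|_].
  by rewrite subrr normr0 add0r.
by rewrite -mulr_coth_norm; ring.
Qed.

Lemma DN_expi nu rho a c m : 0 <= nu -> nu < 1 -> 0 < a -> rho = expR (- a) ->
  DN nu rho (fun x => c%:C * expi m x)
    (fun x => (dn_eigenvalue a nu m)%:C * (c%:C * expi m x)).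
Proof.
move=> nu0 nu1 a0 rhoE.
have rho0 : 0 < rho by rewrite rhoE expR_gt0.
have rho1 : rho < 1 by rewrite rhoE expR_lt1 oppr_lt0.
have lnrho : ln rho = - a by rewrite rhoE expRK.
rewrite dn_eigenvalueE; case: eqP => [mnu|/eqP mnu].
  have m0 : m = 0.
    move: nu0 nu1; rewrite -mnu -[1]/(1%:~R) ler0z ltr_int => m0 m1.
    by case: m m0 m1 {mnu} => [[|]|].
  rewrite {}m0 in mnu *; rewrite -mnu.
  (* The resonant case forces m = nu = 0. The profile equals c at 1 and 0 at e^(- a); as [PLn] is 2
     ln r, its coefficient below is halved, and [PPow 0] is the constant 1. *)
  pose g r : R := c * (a^-1 * ln r + 1).
  pose g' r : R := c / a / r.
  have an0 : a != 0 by rewrite gt_eqF.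
  apply: (@DN_msol R 0 rho 0
    (PAdd (PMul (PC (c / a / 2)) PLn) (PMul (PC c) (PPow 0))) g g' c _ rho0 rho1).
  - move=> r x r0; rewrite expr0 mulr1 /= normsq_polar lnXn// mul0r expR0 /g.
    by field.
  - move=> r r0; rewrite /g /g'; have h := is_derive1_ln r0.
    by apply: is_derive_eq; rewrite /GRing.scale /=; field; rewrite an0 gt_eqF.
  - move=> p p0; have [e1 e2] := ehamiltonian_lin 0 (mode_sign 0) 0 (c / a / 2) c PLn (PPow 0) p.
    have [h1 h2] := ehamiltonian_ln (mode_sign 0) p0.
    have [h3 h4] := ehamiltonian_pow 0 (mode_sign 0) 0 0 p0.
    rewrite e1 e2 h1 h2 h3 h4; split; ring.
  - by rewrite /g ln1 mulr0 add0r mulr1.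
  - by rewrite /g lnrho mulrN mulVf// addNr mulr0.
  - by rewrite /g' divr1 mulrC.
  - by apply: cvgM; [exact: cvg_cst|apply: cvgV => //; exact: oner_neq0].
set d := m%:~R - nu; have d0 : d != 0 by rewrite subr_eq0.
pose q := 2 * sinh (a * d).
have ad0 : a * d != 0 by rewrite mulf_neq0// gt_eqF.
have q0 : q != 0 by rewrite mulf_neq0 ?pnatr_eq0//; exact: sinh_neq0.
(* The solution of al + be = c and al e^(- a d) + be e^(a d) = 0. *)
pose al := c * (expR (a * d) / q); pose be := c * (- expR (- (a * d)) / q).
pose n := `|m|%N.
(* On the circle of radius r, |z|^(2 s) |z|^n is r^(2 s + n); these two exponents make it r^d and
   r^(- d). *)
pose s1 := (d - n%:R) / 2; pose s2 := (- d - n%:R) / 2.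
pose g r : R := al * expR (d * ln r) + be * expR (- d * ln r).
pose g' r : R := (al * (d * expR (d * ln r)) + be * (- d * expR (- d * ln r))) / r.
have qE : q = expR (a * d) - expR (- (a * d)) by rewrite /q /sinh; field.
have ms := mode_sign_abs m (R := R); rewrite -/n in ms.
have ms2 : mode_sign m * mode_sign m = 1 :> R.
  by rewrite /mode_sign; case: ifP; rewrite ?mulr1// mulrNN mulr1.
have hs s : (s = s1 \/ s = s2) -> 4 * s * (s + n%:R) = d ^+ 2 - n%:R ^+ 2.
  by rewrite /s1 /s2 => -[->|->]; field.
have n2 : n%:R ^+ 2 = m%:~R ^+ 2 :> R.
  by rewrite -ms exprMn [X in X * _]expr2 ms2 mul1r.
have k1 s : (s = s1 \/ s = s2) ->
    nu ^+ 2 - 2 * nu * mode_sign m * n%:R - 4 * s * (s + n%:R) = 0.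
  by move/hs=> ->; rewrite n2 -mulrA ms /d; ring.
have k2 s : (s = s1 \/ s = s2) ->
    mode_sign m * nu ^+ 2 - 2 * nu * n%:R - 4 * mode_sign m * s * (s + n%:R) = 0.
  move=> /k1 hk; transitivity (mode_sign m *
    (nu ^+ 2 - 2 * nu * mode_sign m * n%:R - 4 * s * (s + n%:R)) +
    2 * nu * n%:R * (mode_sign m * mode_sign m - 1)); first by ring.
  by rewrite hk ms2 subrr !mulr0 addr0.
apply: (@DN_msol R nu rho m
  (PAdd (PMul (PC al) (PPow s1)) (PMul (PC be) (PPow s2))) g g' c _ rho0 rho1).
- move=> r x r0; rewrite /= normsq_polar -/n.
  have e s : expR (s * ln (r ^+ 2)) * r ^+ n = expR ((2 * s + n%:R) * ln r).
    rewrite lnXn// (exprn_expR_ln n r0) -expRD -mulr_natl.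
    by congr expR; ring.
  rewrite mulrDl -(mulrA al) -(mulrA be) !e /g.
  have -> : 2 * s1 + n%:R = d by rewrite /s1; field.
  by have -> : 2 * s2 + n%:R = - d by rewrite /s2; field.
- move=> r r0; rewrite /g /g'.
  have h1 := is_derive_expR_ln d r0; have h2 := is_derive_expR_ln (- d) r0.
  by apply: is_derive_eq; rewrite /GRing.scale /= ?scaler0 ?add0r ?addr0; ring.
- move=> p p0.
  have [e1 e2] := ehamiltonian_lin nu (mode_sign m) n al be (PPow s1) (PPow s2) p.
  have [h1 h2] := ehamiltonian_pow nu (mode_sign m) n s1 p0.
  have [h3 h4] := ehamiltonian_pow nu (mode_sign m) n s2 p0.
  rewrite e1 e2 h1 h2 h3 h4 !k1 ?k2; try by [left|right].
  by split; ring.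
- by rewrite /g ln1 !mulr0 expR0 !mulr1 /al /be -mulrDr -mulrDl qE mulfV ?mulr1// -qE.
- rewrite /g lnrho /al /be (_ : d * - a = - (a * d)); last by ring.
  by rewrite (_ : - d * - a = a * d); ring.
- rewrite /g' ln1 !mulr0 expR0 !mulr1 divr1 /al /be /coth /cosh.
  have -> : sinh (a * d) = q / 2 by rewrite /q; field.
  by field.
- have cE b : {for 1, continuous (fun r : R => expR (b * ln r))}.
    by apply: continuous_expR_ln; exact: ltr01.
  have cM b e : {for 1, continuous (fun r : R => b * (e * expR (e * ln r)))}.
    by apply: cvgM; [exact: cvg_cst|apply: cvgM; [exact: cvg_cst|exact: cE]].
  apply: cvgM; last by apply: cvgV => //; exact: oner_neq0.
  by apply: cvgD; exact: cM.
Qed.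

Lemma DN_fourier_basis nu rho a k : 0 <= nu -> nu < 1 -> 0 < a ->
  rho = expR (- a) ->
  DN nu rho (fourier_basis k)
    (fun x => (dn_eigenvalue a nu (mode k))%:C * fourier_basis k x).
Proof. by move=> *; exact: DN_expi. Qed.

End Eigenvalues.

(** * Expansion of the heat trace *)

Section ExpRemainder.
Context {R : realType}.
Implicit Types (x y t nu : R) (N p n : nat).

Lemma mean_value (f df : R -> R) (x y : R) : x <= y ->
  (forall z : R, is_derive z (1 : R) f (df z)) ->
  exists2 z, x <= z <= y & f y - f x = df z * (y - x).
Proof.
move=> xy dfP.
have [|z zI fE] := MVT_segment xy (fun z _ => dfP z).
  apply: continuous_subspaceT => z; apply: differentiable_continuous.
  by apply/derivable1_diffP; case: (dfP z).
by exists z => //; move: zI; rewrite in_itv.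
Qed.

Definition expN_rem N x : R :=
  expR (- x) - \sum_(p < N) (-1) ^+ p / p`!%:R * x ^+ p.

Lemma expN_remS N x :
  expN_rem N.+1 x = expN_rem N x - (-1) ^+ N / N`!%:R * x ^+ N.
Proof. by rewrite /expN_rem big_ord_recr /= opprD addrA. Qed.

Lemma expN_rem0 x : expN_rem 0 x = expR (- x).
Proof. by rewrite /expN_rem big_ord0 subr0. Qed.

Lemma is_derive_monomial (c : R) n x :
  is_derive x (1 : R) (fun y => c / n.+1`!%:R * y ^+ n.+1) (c / n`!%:R * x ^+ n).
Proof.
have h := is_deriveX n.+1 (@is_derive_id _ _ x (1 : R)).
rewrite exprfctE in h.
have := is_deriveM (@is_derive_cst _ _ _ (c / n.+1`!%:R) x (1 : R)) h.
move/is_derive_eq; apply; rewrite /GRing.scale /= mulr0 addr0 mulr1.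
have n0 : n`!%:R != 0 :> R by rewrite pnatr_eq0 -lt0n fact_gt0.
have n1 : n.+1%:R != 0 :> R by rewrite pnatr_eq0.
by rewrite factS natrM; field; rewrite n0 addrC natr1 n1.
Qed.

Lemma is_derive_expRN x : is_derive x (1 : R) (fun y => expR (- y)) (- expR (- x)).
Proof.
have h : is_derive x (1 : R) (fun y : R => - y) (- 1).
  by apply: is_derive_eq.
have := is_derive1_comp (is_derive_expR (- x)) h.
by move/is_derive_eq; apply; rewrite mulrN1.
Qed.

Lemma is_derive_expN_rem N x :
  is_derive x (1 : R) (expN_rem N.+1) (- expN_rem N x).
Proof.
elim: N => [|N IH].
  have := is_deriveB (is_derive_expRN x) (@is_derive_cst _ _ _ (1 : R) x (1 : R)).
  rewrite subr0 expN_rem0; congr is_derive; apply/funext => y.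
  by rewrite expN_remS expN_rem0 expr0 fact0 divr1 mulr1.
have := is_deriveB IH (is_derive_monomial ((-1) ^+ N.+1) N x).
rewrite -opprD (_ : (- (expN_rem N x + _)) = - expN_rem N.+1 x); last first.
  by rewrite expN_remS exprS; ring.
by congr is_derive; apply/funext => y; rewrite [RHS]expN_remS.
Qed.

Lemma expN_remS_at0 N : expN_rem N.+1 0 = 0.
Proof.
rewrite /expN_rem oppr0 expR0 big_ord_recl /= expr0 fact0 divr1 mulr1.
by rewrite big1 ?addr0 ?subrr// => i _; rewrite expr0n mulr0.
Qed.

(* The bound at order N + 1 follows from the one at order N by integration,
   the derivative of a remainder being minus the previous remainder. *)
Lemma expN_rem_bound N x : 0 <= x -> `|expN_rem N x| <= x ^+ N / N`!%:R.
Proof.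
elim: N x => [|N IH] x x0.
  rewrite expN_rem0 expr0 fact0 divr1 ger0_norm ?expR_ge0//.
  by rewrite expR_le1 oppr_le0.
have key (s : R) : `|s| <= 1 -> s * expN_rem N.+1 x <= x ^+ N.+1 / N.+1`!%:R.
  move=> s1.
  pose h y := 1 / N.+1`!%:R * y ^+ N.+1 - s * expN_rem N.+1 y.
  have dh (y : R) : is_derive y (1 : R) h (1 / N`!%:R * y ^+ N + s * expN_rem N y).
    have d1 := is_deriveM (@is_derive_cst _ _ _ s y (1 : R)) (is_derive_expN_rem N y).
    have := is_deriveB (is_derive_monomial 1 N y) d1.
    by move/is_derive_eq; apply; rewrite /GRing.scale /=; ring.
  have [z /andP[z0 zx]] := mean_value x0 dh.
  rewrite /h expN_remS_at0 expr0n /= !mulr0 !subr0 => hE.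
  have : 0 <= (1 / N`!%:R * z ^+ N + s * expN_rem N z) * x.
    apply: mulr_ge0 => //.
    have := IH z z0; have : `|s * expN_rem N z| <= `|expN_rem N z|.
      by rewrite normrM ler_piMl.
    rewrite mul1r mulrC ler_norml => /andP[+ _]; lra.
  by rewrite -hE subr_ge0 mul1r [leRHS]mulrC.
rewrite ler_norml; apply/andP; split.
  by rewrite lerNl; have := key (-1); rewrite normrN1 mulN1r; apply.
by have := key 1; rewrite normr1 mul1r; apply.
Qed.

(** The factor y - x is what counts: at t lambda and t |m - nu| it is t times the defect, whose
    decay makes the remainders summable over the modes. *)
Lemma expN_rem_diff N x y : 0 <= x <= y ->
  `|expN_rem N.+1 y - expN_rem N.+1 x| <= (y - x) * (y ^+ N / N`!%:R).
Proof.
move=> /andP[x0 xy].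
have [z /andP[xz zy] ->] := mean_value xy (is_derive_expN_rem N).
have z0 : 0 <= z by exact: le_trans xz.
rewrite normrM normrN mulrC ger0_norm ?subr_ge0// ler_wpM2l ?subr_ge0//.
apply: le_trans (expN_rem_bound N z0) _.
rewrite ler_wpM2r ?invr_ge0// lerXn2r// nnegrE; exact: le_trans zy.
Qed.

(** One term of the series of e^(2 x). The factor 2^(-N) makes the remainders vanish as N grows, and
    e^(2 x) is left for the decay of the defects to absorb. *)
Lemma monomial_le_expR N x : 0 <= x ->
  x ^+ N / N`!%:R <= 2^-1 ^+ N * expR (2 * x).
Proof.
move=> x0.
have h : (2 * x) ^+ N / N`!%:R <= expR (2 * x).
  have x2 : 0 <= 2 * x by rewrite mulr_ge0.
  case: N => [|N]; first by rewrite expr0 fact0 divr1 (le_trans _ (expR_ge1Dx _))// lerDl.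
  by apply: le_trans (expR_ge1Dxn N x2); rewrite lerDr.
have -> : x ^+ N / N`!%:R = 2^-1 ^+ N * ((2 * x) ^+ N / N`!%:R).
  by rewrite mulrA -exprMn mulrA mulVf// mul1r.
by rewrite ler_wpM2l// exprn_ge0.
Qed.

(** The coefficient of t is the Bernoulli polynomial B_2 at nu. After multiplication by t (1 - e^(-
    t)) the Taylor polynomials cancel up to an error of at most 2 t^4, and that factor is at least
    t^2 / 2. *)
Lemma heat_quotient_expansion nu t : 0 <= nu <= 1 -> 0 < t <= 1 ->
  `|(expR (- (t * nu)) + expR (- (t * (1 - nu)))) / (1 - expR (- t)) -
    (2 / t + (6^-1 - nu + nu ^+ 2) * t)| <= 4 * t ^+ 2.
Proof.
move=> /andP[nu0 nu1] /andP[t0 t1].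
have tn : t != 0 by rewrite gt_eqF.
have rem3 x : expR (- x) = 1 - x + x ^+ 2 / 2 + expN_rem 3 x.
  rewrite !expN_remS expN_rem0 /=; rewrite (_ : 2`! = 2)//= fact0 (_ : 1`! = 1)//.
  by rewrite !expr0 !expr1; field.
have rem4 x : expR (- x) = 1 - x + x ^+ 2 / 2 - x ^+ 3 / 6 + expN_rem 4 x.
  by rewrite [LHS]rem3 [expN_rem 4 x]expN_remS (_ : 3`! = 6)//; field.
set k := 6^-1 - nu + nu ^+ 2.
have k0 : - 1 <= k <= 1 by rewrite /k expr2; apply/andP; split; nra.
set e1 := expN_rem 3 (t * nu); set e2 := expN_rem 3 (t * (1 - nu)).
set e3 := expN_rem 4 t.
have b3 y : 0 <= y <= t -> `|expN_rem 3 y| <= t ^+ 3 / 6.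
  move=> /andP[y0 yt]; apply: le_trans (expN_rem_bound 3 y0) _.
  by rewrite (_ : 3`! = 6)// ler_wpM2r// lerXn2r// nnegrE ltW.
have b1 : `|e1| <= t ^+ 3 / 6 by apply: b3; nra.
have b2 : `|e2| <= t ^+ 3 / 6 by apply: b3; nra.
have b4 : `|e3| <= t ^+ 4 / 24.
  by have := expN_rem_bound 4 (ltW t0); rewrite (_ : 4`! = 24).
have D2 : t / 2 <= 1 - expR (- t).
  have := expN_rem_bound 2 (ltW t0).
  rewrite !expN_remS expN_rem0 fact0 (_ : 1`! = 1)// (_ : 2`! = 2)//.
  rewrite expr0 expr0 expr1 expr1 ler_norml => /andP[_ h].
  have : t ^+ 2 <= t by rewrite expr2 ler_piMl// ltW.
  lra.
have D0 : 0 < 1 - expR (- t) by apply: lt_le_trans D2; rewrite divr_gt0.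
have -> : (expR (- (t * nu)) + expR (- (t * (1 - nu)))) / (1 - expR (- t)) -
    (2 / t + k * t) =
    (t * (expR (- (t * nu)) + expR (- (t * (1 - nu)))) -
     (1 - expR (- t)) * (2 + k * t ^+ 2)) / (t * (1 - expR (- t))).
  by field; rewrite tn gt_eqF.
rewrite normrM normfV (ger0_norm (mulr_ge0 (ltW t0) (ltW D0))).
rewrite ler_pdivrMr ?mulr_gt0//.
apply: (@le_trans _ _ (2 * t ^+ 4)); last first.
  have t3 : 0 <= t ^+ 3 by rewrite exprn_ge0// ltW.
  rewrite (_ : 4 * t ^+ 2 * (t * _) = 4 * t ^+ 3 * (1 - expR (- t))); last by ring.
  rewrite (_ : 2 * t ^+ 4 = 4 * t ^+ 3 * (t / 2)); last by field.
  by rewrite ler_wpM2l// mulr_ge0.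
have -> : t * (expR (- (t * nu)) + expR (- (t * (1 - nu)))) -
     (1 - expR (- t)) * (2 + k * t ^+ 2) =
  t * (e1 + e2) + e3 * (2 + k * t ^+ 2) + k * (t ^+ 4 / 2 - t ^+ 5 / 6).
  rewrite (rem3 (t * nu)) (rem3 (t * (1 - nu))) (rem4 t) -/e1 -/e2 -/e3 /k.
  by field.
move: b1 b2 b4; rewrite !ler_norml.
move=> /andP[l1 u1] /andP[l2 u2] /andP[l3 u3].
have /andP[k00 k01] := k0.
have t2 : 0 <= t ^+ 2 <= 1 by rewrite expr2; apply/andP; split; nra.
have t4 : 0 <= t ^+ 4 by rewrite exprn_ge0// ltW.
have t5 : 0 <= t ^+ 5 <= t ^+ 4.
  by rewrite exprn_ge0 ?(ltW t0)//= exprS ler_piMl.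
have s1 : - (t ^+ 4 / 3) <= t * (e1 + e2) <= t ^+ 4 / 3.
  have -> : t ^+ 4 / 3 = t * (t ^+ 3 / 3) by field.
  by rewrite -mulrN !ler_pM2l//; lra.
have kt : 1 <= 2 + k * t ^+ 2 <= 3.
  by case/andP: t2 => ? ?; apply/andP; split; nra.
have s2 : `|e3 * (2 + k * t ^+ 2)| <= t ^+ 4 / 24 * 3.
  case/andP: kt => kt1 kt2; rewrite normrM ler_pM// ?ler_norml.
    by apply/andP.
  by apply/andP; split; lra.
have s3 : `|k * (t ^+ 4 / 2 - t ^+ 5 / 6)| <= 1 * (t ^+ 4 / 2).
  rewrite normrM ler_pM// ?ler_norml; first by apply/andP.
  by case/andP: t5 => ? ?; apply/andP; split; lra.
move: s1 s2 s3; rewrite !ler_norml => /andP[? ?] /andP[? ?] /andP[? ?].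
by apply/andP; split; lra.
Qed.

End ExpRemainder.

(** * The heat sum of the |m - nu| and the decay of the defects *)

Section SpectralSums.
Context {R : realType}.
Implicit Types (u v w : nat -> R) (x y t nu a : R) (N p n k : nat) (m : int).

Definition mode_dist nu k : R := `|(mode k)%:~R - nu|.

Lemma mode_dist_even nu j : 0 <= nu -> mode_dist nu j.*2 = j%:R + nu.
Proof.
move=> nu0; rewrite /mode_dist /mode odd_double doubleK rmorphN /= -opprD normrN.
by rewrite ger0_norm// addr_ge0.
Qed.

Lemma mode_dist_odd nu j : nu < 1 -> mode_dist nu j.*2.+1 = j%:R + (1 - nu).
Proof.
move=> nu1; rewrite /mode_dist /mode /= odd_double /= uphalf_double.
rewrite -[(j.+1)%:~R]/(j.+1%:R) -natr1 -addrA ger0_norm//.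
by rewrite addr_ge0// subr_ge0 ltW.
Qed.

(** The terms are nonnegative, so the partial sums increase and lie between those with an even
    number of terms. *)
Lemma cvg_series_pairs u (l : R) : (forall k, 0 <= u k) ->
  series (fun j => u j.*2 + u j.*2.+1) @ \oo --> l -> series u @ \oo --> l.
Proof.
move=> u0; set v := fun j => _.
have v0 j : 0 <= v j by rewrite addr_ge0.
have uv n : series u n.*2 = series v n.
  elim: n => [|n IH]; first by rewrite /series /= !big_geq.
  by rewrite doubleS 2!seriesSr IH [RHS]seriesSr addrA.
have ndu : nondecreasing_seq (series u).
  by apply/nondecreasing_seqP => n; rewrite seriesSr lerDl.
have ndv : nondecreasing_seq (series v).
  by apply/nondecreasing_seqP => n; rewrite seriesSr lerDl.
move=> vl; have ub n : series u n <= l.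
  apply: (@le_trans _ _ (series u n.*2)).
    by apply: ndu; rewrite -addnn leq_addr.
  rewrite uv -(cvg_lim (@norm_hausdorff _ _) vl).
  by apply: nondecreasing_cvgn_le => //; apply/cvg_ex; exists l.
apply/cvgrPdist_lt => e e0.
move/cvgrPdist_lt : vl => /(_ _ e0)[N _ hN].
exists N.*2 => // n /= Nn; have := hN N (leqnn N); rewrite /= -uv.
have := ndu _ _ Nn; have := ub n; have := ub N.*2.
move=> h1 h2 h3; rewrite !ger0_norm ?subr_ge0//; lra.
Qed.

Lemma cvg_heat_integer_shift nu t : 0 <= nu -> nu < 1 -> 0 < t ->
  series (fun k => expR (- (t * mode_dist nu k))) @ \oo -->
  (expR (- (t * nu)) + expR (- (t * (1 - nu)))) / (1 - expR (- t)).
Proof.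
move=> nu0 nu1 t0; apply: cvg_series_pairs => [k|]; first exact: expR_ge0.
have -> : (fun j => expR (- (t * mode_dist nu j.*2)) + expR (- (t * mode_dist nu j.*2.+1))) =
    geometric (expR (- (t * nu)) + expR (- (t * (1 - nu)))) (expR (- t)).
  apply/funext => j; rewrite mode_dist_even// mode_dist_odd// /= mulrDl -expRM_natl -!expRD.
  by congr (expR _ + expR _); rewrite -mulr_natl; ring.
apply: cvg_geometric_series; rewrite ger0_norm ?expR_ge0//.
by rewrite expR_lt1 oppr_lt0.
Qed.

Lemma heat_quotientE nu t : 0 < t ->
  Defs.cosh (t * (nu - 2^-1)) / Defs.sinh (t / 2) =
  (expR (- (t * nu)) + expR (- (t * (1 - nu)))) / (1 - expR (- t)).
Proof.
move=> t0; rewrite /Defs.cosh /Defs.sinh.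
have e0 : expR (- (t / 2)) != 0 by rewrite gt_eqF ?expR_gt0.
have h1 : expR (- (t * nu)) = expR (- (t * (nu - 2^-1))) * expR (- (t / 2)).
  by rewrite -expRD; congr expR; field.
have h2 : expR (- (t * (1 - nu))) = expR (t * (nu - 2^-1)) * expR (- (t / 2)).
  by rewrite -expRD; congr expR; field.
have h3 : 1 - expR (- t) = (expR (t / 2) - expR (- (t / 2))) * expR (- (t / 2)).
  by rewrite mulrBl -!expRD subrr expR0; congr (_ - expR _); field.
have s0 : expR (t / 2) - expR (- (t / 2)) != 0.
  by rewrite gt_eqF// subr_gt0 ltr_expR; lra.
by rewrite h1 h2 h3; field; rewrite s0 e0.
Qed.

Lemma coth_sub1 x : 0 < x ->
  Defs.coth x - 1 = 2 * expR (- x) / (expR x - expR (- x)).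
Proof.
move=> x0; rewrite /Defs.coth /Defs.cosh /Defs.sinh.
have s0 : expR x - expR (- x) != 0 by rewrite gt_eqF// subr_gt0 ltr_expR; lra.
by field.
Qed.

(** With y = a d, the defect is 2 d e^(- y) / (e^y - e^(- y)), and e^y - e^(- y) >= y e^(- y / 2).
    The d of y cancels the one in front, so giving up half of the exponent buys a bound uniform as d
    tends to 0. *)
Lemma coth_defect_bounds a nu m : 0 < a ->
  0 <= coth_defect a nu m <= 2 / a * expR (- (a / 2 * `|m%:~R - nu|)).
Proof.
move=> a0; rewrite /coth_defect; case: eqP => [->|/eqP mnu].
  rewrite subrr normr0 mulr0 oppr0 expR0 mulr1 invr_ge0 ltW//=.
  by rewrite ler_peMl ?invr_ge0 ?ltW// ltr1n.
set d := `|_|; have d0 : 0 < d by rewrite normr_gt0 subr_eq0.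
set y := a * d; have y0 : 0 < y by rewrite mulr_gt0.
have s0 : 0 < expR y - expR (- y) by rewrite subr_gt0 ltr_expR; lra.
have ey := expR_gt0 (- y).
rewrite coth_sub1//; apply/andP; split.
  by rewrite mulr_ge0 ?(ltW d0)// divr_ge0 ?ltW// mulr_gt0.
have E1 : expR (- y) = expR (- (y / 2)) * expR (- (y / 2)).
  by rewrite -expRD; congr expR; field.
have E2 : expR y * expR (- (y / 2)) = expR (y / 2).
  by rewrite -expRD; congr expR; field.
have -> : a / 2 * d = y / 2 by rewrite /y; field.
set h := expR (- (y / 2)); have h0 : 0 < h by exact: expR_gt0.
have key : y * h <= expR y - expR (- y).
  have -> : expR y - expR (- y) = h * (expR (y + y / 2) - h).
    by rewrite mulrBr -E1 -expRD; congr (expR _ - _); field.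
  rewrite mulrC ler_pM2l//.
  have : h <= 1 by rewrite expR_le1; lra.
  by have := expR_ge1Dx (y + y / 2); lra.
apply: (@le_trans _ _ (d * (2 * expR (- y) / (y * h)))).
  rewrite ler_pM2l// ler_pM2l ?mulr_gt0// lef_pV2// posrE//.
  by rewrite mulr_gt0.
rewrite E1 -/h /y le_eqVlt; apply/orP; left; apply/eqP.
by field; rewrite !gt_eqF.
Qed.

End SpectralSums.

(** * Power series of the difference of the two heat traces *)

Section Expansion.
Context {R : realType} (nu a : R).
Hypotheses (nu0 : 0 <= nu) (nu1 : nu < 1) (a0 : 0 < a).
Implicit Types (u v w : nat -> R) (x y s t : R) (N p n k : nat).

Definition mode_gap k : R := coth_defect a nu (mode k).
Definition dn_lambda k : R := dn_eigenvalue a nu (mode k).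

Lemma dn_lambdaE k : dn_lambda k = mode_dist nu k + mode_gap k. Proof. by []. Qed.

Lemma dn_lambda_subr k : dn_lambda k - mode_dist nu k = mode_gap k.
Proof. by rewrite dn_lambdaE addrAC subrr add0r. Qed.

Lemma mode_dist_ge0 k : 0 <= mode_dist nu k. Proof. exact: normr_ge0. Qed.

Lemma mode_gap_ge0 k : 0 <= mode_gap k.
Proof. by have /andP[] := coth_defect_bounds nu (mode k) a0. Qed.

Lemma mode_dist_le_dn_lambda k : mode_dist nu k <= dn_lambda k.
Proof. by rewrite dn_lambdaE lerDl mode_gap_ge0. Qed.

Lemma dn_lambda_ge0 k : 0 <= dn_lambda k.
Proof. exact: le_trans (mode_dist_ge0 k) (mode_dist_le_dn_lambda k). Qed.

Definition gap_weight k : R := expR (- (a / 4 * mode_dist nu k)).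

Lemma gap_weight_ge0 k : 0 <= gap_weight k. Proof. exact: expR_ge0. Qed.

Lemma cvg_gap_weight : cvgn (series gap_weight).
Proof.
apply/cvg_ex; eexists; apply: cvg_heat_integer_shift => //.
by rewrite divr_gt0.
Qed.

Definition gap_cst : R := 2 / a * expR 2^-1.

Lemma gap_cst_ge0 : 0 <= gap_cst.
Proof. by rewrite mulr_ge0 ?expR_ge0// divr_ge0// ltW. Qed.

(** Half of the decay rate a / 2 of the defect pays for e^(s |m - nu|) and the rate a / 4 remains in
    [gap_weight]. The defect is at most 2 / a, so its own share of s lambda is at most 1 / 2, whence
    e^(1 / 2) in [gap_cst]. *)
Lemma gap_expR_le s k : 0 <= s <= a / 4 ->
  mode_gap k * expR (s * dn_lambda k) <= gap_cst * gap_weight k.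
Proof.
move=> /andP[s0 sa]; have /andP[g0 g1] := coth_defect_bounds nu (mode k) a0.
rewrite -/(mode_gap k) -/(mode_dist nu k) in g0 g1.
have d0 := mode_dist_ge0 k.
have g2 : mode_gap k <= 2 / a.
  apply: le_trans g1 _; rewrite ler_piMr ?divr_ge0 ?(ltW a0)//.
  by rewrite expR_le1 oppr_le0 mulr_ge0// divr_ge0// ltW.
have sg : s * mode_gap k <= 2^-1.
  apply: (@le_trans _ _ (a / 4 * (2 / a))); first exact: ler_pM.
  by rewrite le_eqVlt; apply/orP; left; apply/eqP; field; rewrite gt_eqF.
apply: (@le_trans _ _ (2 / a * expR (- (a / 2 * mode_dist nu k)) *
    expR (s * mode_dist nu k + 2^-1))).
  by apply: ler_pM; rewrite ?expR_ge0// ler_expR dn_lambdaE mulrDr lerD2l.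
rewrite /gap_cst /gap_weight -!mulrA ler_pM2l//.
rewrite ler_pM2l ?invr_gt0// -!expRD ler_expR.
have := ler_wpM2r d0 sa; lra.
Qed.

Lemma cvg_heat_trace t : 0 < t -> cvgn (series (fun k => expR (- (t * dn_lambda k)))).
Proof.
move=> t0; apply: (@series_le_cvg _ _ (fun k => expR (- (t * mode_dist nu k)))).
- by move=> k; exact: expR_ge0.
- by move=> k; exact: expR_ge0.
- by move=> k; rewrite ler_expR lerN2 ler_pM2l// mode_dist_le_dn_lambda.
- by apply/cvg_ex; eexists; exact: cvg_heat_integer_shift.
Qed.

Definition heat_trace t : R := limn (series (fun k => expR (- (t * dn_lambda k)))).

Definition exp_rem N t k : R :=
  expN_rem N (t * dn_lambda k) - expN_rem N (t * mode_dist nu k).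

(** The range of t comes from the factor e^(2 t lambda) of [monomial_le_expR]: [gap_expR_le] needs 2
    t <= a / 4. *)
Lemma exp_rem_bound N t k : 0 <= t <= a / 8 ->
  `|exp_rem N.+1 t k| <= t * 2^-1 ^+ N * gap_cst * gap_weight k.
Proof.
move=> /andP[t0 ta].
have tl : 0 <= t * mode_dist nu k <= t * dn_lambda k.
  by rewrite mulr_ge0 ?mode_dist_ge0//= ler_wpM2l// mode_dist_le_dn_lambda.
apply: le_trans (expN_rem_diff N tl) _.
rewrite -mulrBr dn_lambda_subr.
rewrite -[leRHS]mulrA -[leRHS]mulrA -[leLHS]mulrA ler_wpM2l//.
have h := monomial_le_expR N (mulr_ge0 t0 (dn_lambda_ge0 k)).
apply: le_trans (ler_wpM2l (mode_gap_ge0 k) h) _.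
rewrite mulrCA ler_wpM2l ?exprn_ge0// mulrA gap_expR_le//.
by apply/andP; split; lra.
Qed.

(** The general bound is only of order t. To get t^2, the factor t lambda is kept and lambda is
    absorbed by lambda <= (4 / a) e^(a lambda / 4). *)
Lemma exp_rem2_bound t k : 0 <= t <= a / 8 ->
  `|exp_rem 2 t k| <= t ^+ 2 * (4 / a * gap_cst) * gap_weight k.
Proof.
move=> /andP[t0 ta].
have tl : 0 <= t * mode_dist nu k <= t * dn_lambda k.
  by rewrite mulr_ge0 ?mode_dist_ge0//= ler_wpM2l// mode_dist_le_dn_lambda.
apply: le_trans (expN_rem_diff 1 tl) _.
rewrite -mulrBr dn_lambda_subr.
rewrite expr1 (_ : 1`! = 1%N)// divr1.
have -> : t * mode_gap k * (t * dn_lambda k) = t ^+ 2 * (mode_gap k * dn_lambda k) by ring.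
rewrite -[leRHS]mulrA ler_wpM2l ?sqr_ge0//.
have a4 : 0 <= a / 4 <= a / 4 by rewrite lexx divr_ge0// ltW.
have h := gap_expR_le k a4.
have l1 : dn_lambda k <= 4 / a * expR (a / 4 * dn_lambda k).
  have := expR_ge1Dx (a / 4 * dn_lambda k) => e1.
  have {}e1 : a / 4 * dn_lambda k <= expR (a / 4 * dn_lambda k) by lra.
  have -> : dn_lambda k = 4 / a * (a / 4 * dn_lambda k) by field; rewrite gt_eqF.
  rewrite ler_wpM2l ?divr_ge0 ?(ltW a0)//.
  by rewrite (_ : a / 4 * _ = a / 4 * dn_lambda k)//; field; rewrite gt_eqF.
apply: le_trans (ler_wpM2l (mode_gap_ge0 k) l1) _.
by rewrite mulrCA -[leRHS]mulrA ler_wpM2l// divr_ge0// ltW.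
Qed.

Definition exp_rem_sum N t : R := limn (series (exp_rem N t)).

Let t_bounds t : 0 < t <= a / 8 -> 0 <= t <= a / 8.
Proof. by case/andP=> /ltW -> ->. Qed.

Lemma cvg_exp_rem N t : 0 < t <= a / 8 -> series (exp_rem N.+1 t) @ \oo --> exp_rem_sum N.+1 t.
Proof.
move=> /t_bounds tb; have /andP[t0 _] := tb.
have [] // := @series_dominated R (exp_rem N.+1 t) gap_weight (t * 2^-1 ^+ N * gap_cst)
  gap_weight_ge0 _ cvg_gap_weight _.
- by rewrite mulr_ge0 ?gap_cst_ge0// mulr_ge0// exprn_ge0.
- by move=> k; exact: exp_rem_bound.
Qed.

Lemma exp_rem_sum_bound N t : 0 < t <= a / 8 ->
  `|exp_rem_sum N.+1 t| <= t * 2^-1 ^+ N * gap_cst * limn (series gap_weight).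
Proof.
move=> /t_bounds tb; have /andP[t0 _] := tb.
have [] // := @series_dominated R (exp_rem N.+1 t) gap_weight (t * 2^-1 ^+ N * gap_cst)
  gap_weight_ge0 _ cvg_gap_weight _.
- by rewrite mulr_ge0 ?gap_cst_ge0// mulr_ge0// exprn_ge0.
- by move=> k; exact: exp_rem_bound.
Qed.

Lemma exp_rem_sum2_bound t : 0 < t <= a / 8 ->
  `|exp_rem_sum 2 t| <= t ^+ 2 * (4 / a * gap_cst) * limn (series gap_weight).
Proof.
move=> /t_bounds tb; have /andP[t0 _] := tb.
have [] // := @series_dominated R (exp_rem 2 t) gap_weight (t ^+ 2 * (4 / a * gap_cst))
  gap_weight_ge0 _ cvg_gap_weight _.
- rewrite mulr_ge0 ?exprn_ge0// mulr_ge0 ?gap_cst_ge0//.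
  by rewrite divr_ge0// ltW.
- by move=> k; exact: exp_rem2_bound.
Qed.

Definition heat_coef p : R :=
  (-1) ^+ p / p`!%:R * limn (series (fun k => dn_lambda k ^+ p - mode_dist nu k ^+ p)).

(** Mode by mode, consecutive remainders differ by a monomial. Dividing by its nonzero coefficient
    also shows that the series inside [heat_coef] converges. *)
Lemma heat_coefE p t : 0 < t <= a / 8 ->
  heat_coef p.+1 * t ^+ p.+1 = exp_rem_sum p.+1 t - exp_rem_sum p.+2 t.
Proof.
move=> tb; have /andP[t0 _] := tb.
set q : R := (-1) ^+ p.+1 / p.+1`!%:R.
set v := fun k => dn_lambda k ^+ p.+1 - mode_dist nu k ^+ p.+1.
have q0 : q * t ^+ p.+1 != 0.
  apply: mulf_neq0; last by rewrite expf_neq0// gt_eqF.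
  apply: mulf_neq0; first by rewrite signr_eq0.
  by rewrite invr_neq0// pnatr_eq0 -lt0n fact_gt0.
have vE : series v = (fun n => (q * t ^+ p.+1)^-1 *
    (series (exp_rem p.+1 t) n - series (exp_rem p.+2 t) n)).
  apply/funext => n; rewrite /series /= -sumrB mulr_sumr; apply: eq_bigr => k _.
  rewrite /exp_rem (expN_remS p.+1) (expN_remS p.+1) -/q !exprMn /v.
  apply: (mulfI q0); rewrite mulrA mulfV// mul1r; ring.
have vc : series v @ \oo -->
    (q * t ^+ p.+1)^-1 * (exp_rem_sum p.+1 t - exp_rem_sum p.+2 t).
  rewrite vE; apply: cvg_seqZ.
  by apply: cvgB; exact: cvg_exp_rem.
rewrite /heat_coef -/q -/v (cvg_lim (@norm_hausdorff _ _) vc).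
by rewrite mulrAC mulrA mulfV// mul1r.
Qed.

Lemma sum_heat_coefE n t : 0 < t <= a / 8 ->
  series (fun p => heat_coef p.+1 * t ^+ p.+1) n = exp_rem_sum 1 t - exp_rem_sum n.+1 t.
Proof.
move=> tb; elim: n => [|n IH]; first by rewrite /series /= big_geq// subrr.
by rewrite seriesSr IH heat_coefE//; ring.
Qed.

(** At order 1 the constants subtracted from the two exponentials cancel. *)
Lemma exp_rem_sum1E t : 0 < t <= a / 8 ->
  exp_rem_sum 1 t = heat_trace t - Defs.cosh (t * (nu - 2^-1)) / Defs.sinh (t / 2).
Proof.
move=> /andP[t0 _]; rewrite heat_quotientE//.
have h := cvg_heat_integer_shift nu0 nu1 t0.
apply: cvg_lim => //.
have -> : series (exp_rem 1 t) = (fun n => series (fun k => expR (- (t * dn_lambda k))) n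
    - series (fun k => expR (- (t * mode_dist nu k))) n).
  apply/funext => n; rewrite /series /= -sumrB; apply: eq_bigr => k _.
  by rewrite /exp_rem !expN_remS !expN_rem0 !expr0; ring.
by apply: cvgB => //; exact: cvg_heat_trace.
Qed.

Lemma cvg_power_series t : 0 < t <= a / 8 ->
  series (fun p => heat_coef p.+1 * t ^+ p.+1) @ \oo -->
    heat_trace t - Defs.cosh (t * (nu - 2^-1)) / Defs.sinh (t / 2).
Proof.
move=> tb; rewrite -exp_rem_sum1E//.
have -> : series (fun p => heat_coef p.+1 * t ^+ p.+1) =
    (fun n => exp_rem_sum 1 t - exp_rem_sum n.+1 t).
  by apply/funext => n; exact: sum_heat_coefE.
rewrite -[X in _ --> X]subr0; apply: cvgB; first exact: cvg_cst.
have gc : (fun n => t * gap_cst * limn (series gap_weight) * 2^-1 ^+ n) @ \oo --> (0 : R).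
  have := @cvg_seqZ _ (t * gap_cst * limn (series gap_weight)) _ _ (@cvg_expr R 2^-1 _).
  by rewrite mulr0; apply; rewrite ger0_norm// invf_lt1// ltr1n.
apply/cvgrPdist_lt => e e0; move/cvgrPdist_lt : gc => /(_ _ e0)[N _ hN].
exists N => // n /hN /=; rewrite !sub0r !normrN => h; apply: le_lt_trans h.
apply: le_trans (exp_rem_sum_bound n tb) _; apply: le_trans (ler_norm _).
by rewrite le_eqVlt; apply/orP; left; apply/eqP; ring.
Qed.

Lemma heat_coef1 : (heat_coef 1)%:E = (- \esum_(m in [set: int]) (coth_defect a nu m)%:E)%E.
Proof.
have gc : series mode_gap @ \oo --> limn (series mode_gap).
  have [] // := @series_dominated R mode_gap gap_weight gap_cst gap_weight_ge0 gap_cst_ge0 cvg_gap_weight _.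
  move=> k; rewrite ger0_norm ?mode_gap_ge0//.
  have /(gap_expR_le k) : 0 <= (0 : R) <= a / 4 by rewrite lexx divr_ge0// ltW.
  by rewrite mul0r expR0 mulr1.
have -> : \esum_(m in [set: int]) (coth_defect a nu m)%:E =
    \esum_(k in [set: nat]) (mode_gap k)%:E.
  apply: reindex_esum; split=> //.
    by move=> j k _ _; exact: (can_inj modeK).
  (* The sum over the integers is pulled back along the enumeration [mode], a bijection from the
     naturals. *)
  by move=> m _; exists (mode_index m) => //; exact: mode_indexK.
rewrite -nneseries_esumT; last by move=> k; rewrite lee_fin mode_gap_ge0.
rewrite (nneseries_EFin gc) -EFinN; congr EFin.
rewrite /heat_coef expr1 (_ : 1`! = 1%N)// divr1 mulN1r; congr (- limn (series _)).
by apply/funext => k; rewrite !expr1 dn_lambda_subr.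
Qed.

Lemma heat_trace_bigO : exists K : R, forall t, 0 < t <= Num.min 1 (a / 8) ->
  `|heat_trace t - (2 / t + (6^-1 - nu + nu ^+ 2 + heat_coef 1) * t)| <= K * t ^+ 2.
Proof.
exists (4 + 4 / a * gap_cst * limn (series gap_weight)) => t.
rewrite le_min => /andP[t0 /andP[t1 ta]].
have tb : 0 < t <= a / 8 by rewrite t0.
have h1 := exp_rem_sum1E tb; have h2 := heat_coefE 0 tb; rewrite !expr1 in h2.
have nub : 0 <= nu <= 1 by rewrite nu0 ltW.
have h3 := @heat_quotient_expansion R nu t nub.
rewrite t0 t1 in h3; have {}h3 := h3 isT.
rewrite -heat_quotientE// in h3.
have h4 := exp_rem_sum2_bound tb.
have -> : heat_trace t - (2 / t + (6^-1 - nu + nu ^+ 2 + heat_coef 1) * t) =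
  (Defs.cosh (t * (nu - 2^-1)) / Defs.sinh (t / 2) -
    (2 / t + (6^-1 - nu + nu ^+ 2) * t)) + exp_rem_sum 2 t.
  have -> : exp_rem_sum 2 t = exp_rem_sum 1 t - heat_coef 1 * t by lra.
  by rewrite h1; ring.
apply: le_trans (ler_normD _ _) _.
apply: le_trans (lerD h3 h4) _.
by rewrite le_eqVlt; apply/orP; left; apply/eqP; ring.
Qed.

End Expansion.

(** * The semigroup as a multiplier operator, and the conclusion *)

Lemma is_heat_trace_DN (R : realType) (nu rho a t : R) :
  0 <= nu -> nu < 1 -> 0 < a -> rho = expR (- a) -> 0 < t ->
  is_heat_trace (DN nu rho) t (heat_trace nu a t).
Proof.
move=> nu0 nu1 a0 rhoE t0.
pose w k := expR (- (t * dn_lambda nu a k)).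
have w0 k : 0 <= w k by exact: expR_ge0.
have cw : cvgn (series w) by exact: cvg_heat_trace.
have bf := @fourier_basis_complete R.
have fB k x : sqmod (@fourier_basis R k x) <= sqmod ((Num.sqrt (2 * pi))^-1)%:C.
  by rewrite /fourier_basis sqmodM sqmod_expi mulr1.
exists (multiplier (@fourier_basis R) w); last exact: multiplier_trace fB w0 cw.
exists (@fourier_basis R), (dn_lambda nu a); split => //.
  by move=> k; exact: DN_fourier_basis.
move=> f fL; have TL := multiplier_inL2 bf fB w0 cw fL.
split=> //; rewrite /L2cvg.
have -> : (fun n => L2norm2 (fun x => \sum_(k < n) (expR (- t * dn_lambda nu a k))%:C *
    L2dot f (fourier_basis k) * fourier_basis k x -
    multiplier (@fourier_basis R) w f x)) =
  (fun n => (L2sq (fun x => multiplier_psum (@fourier_basis R) w f n x -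
    multiplier (@fourier_basis R) w f x))%:E).
  apply/funext => n; rewrite -L2norm2E.
    congr L2norm2; apply/funext => x; congr (_ - _).
    by apply: eq_bigr => k _; rewrite /w mulNr.
  apply: inL2_sub => //.
  apply: (@inL2_sum _ (fun k x =>
    (w k)%:C * L2dot f (fourier_basis k) * fourier_basis k x)) => k.
  by apply: inL2_scale; exact: fourier_basis_inL2.
apply/fine_cvgP; split; first exact: nearW.
exact: multiplier_L2cvg bf fB w0 cw f fL.
Qed.

Local Close Scope complex_scope.

Theorem mainTheorem8 (R : realType) (nu rho a : R)
    (nu_ge0 : 0 <= nu) (nu_lt1 : nu < 1)
    (rho_gt0 : 0 < rho) (rho_lt1 : rho < 1)
    (a_gt0 : 0 < a) (rhoE : rho = expR (- a)) :
  exists Z : R -> R,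
    (forall t, 0 < t -> is_heat_trace (DN nu rho) t (Z t)) /\
    exists c : nat -> R,
      [/\ \forall t \near (0 : R)^'+,
            series (fun p => c p.+1 * t ^+ p.+1) @ \oo -->
              Z t - cosh (t * (nu - 2^-1)) / sinh (t / 2),
          (c 1%N)%:E =
            (- \esum_(m in [set: int]) (coth_defect a nu m)%:E)%E &
          (fun t => Z t - (2 / t + (6^-1 - nu + nu ^+ 2 + c 1%N) * t))
            =O_ ((0 : R)^'+) (fun t => t ^+ 2)].
Proof.
have a8 : 0 < a / 8 by rewrite divr_gt0.
exists (heat_trace nu a); split=> [t t0|]; first exact: is_heat_trace_DN.
exists (heat_coef nu a); split.
- near=> t; apply: cvg_power_series => //; apply/andP; split=> //.
  by near: t; exact: nbhs_right_le.
- exact: (heat_coef1 nu_ge0 nu_lt1 a_gt0).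
- have [K hK] := heat_trace_bigO nu_ge0 nu_lt1 a_gt0.
  (* The constant must be positive, while K itself carries no sign information. *)
  apply/eqO_exP; exists (`|K| + 1); first by rewrite ltr_wpDl.
  near=> t; rewrite (le_trans (hK t _))//.
    apply/andP; split=> //; near: t; apply: nbhs_right_le.
    by rewrite lt_min ltr01.
  rewrite [X in _ <= _ * X]ger0_norm ?sqr_ge0// ler_wpM2r ?sqr_ge0//.
  by rewrite (le_trans (ler_norm K))// lerDl.
Unshelve. all: by end_near. Qed.
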